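(* Let $\mathbb E$ be a Euclidean space, $\mathcal V\subset\mathbb E$ a manifold of class $C^3$ with $\mathcal V\neq\mathbb E$, and $E$ a proper affine subspace of $\mathbb E$. Let $\zeta\in E\cap\mathcal V$ be such that $\Pi_{\mathcal V}$ is $C^2$ around $\zeta$ and $\mathcal V$ and $E$ intersect transversally at $\zeta$. Let $\varphi(x)=\Pi_{E\cap T_{\Pi_{\mathcal V}(x)}\mathcal V}(x)$, which is well defined for $x$ near $\zeta$, and let $\mathcal W=E\cap\mathcal V\cap U$ for a small enough open neighborhood $U$ of $\zeta$ (see the context). There exist $\nu,\gamma,\gamma'>0$ such that, for all $x_0\in B_\nu(\zeta)$, the sequence $(x_i)$ given by $x_{i+1}=\varphi(x_i)$ is well defined and converges towards a point $x_\infty\in\mathcal W$, with 1. $\|x_{i+1}-x_\infty\|\le\gamma\,\|x_i-x_\infty\|^2$ for all $i\ge 0$; 2. $\|\Pi_{\mathcal W}(x_0)-x_\infty\|\le\gamma'\,\|\Pi_{\mathcal W}(x_0)-x_0\|^2$.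
   Context: Manifolds are embedded submanifolds of $\mathbb E$. For an affine space $F$, $F^0$ denotes its underlying vector space. For $x\in\mathcal V$, $T_x\mathcal V=x+T_x\mathcal V^0$ is the affine tangent space at $x$, with underlying vector space $T_x\mathcal V^0$. $B_\nu(\zeta)$ is the open ball of center $\zeta$ and radius $\nu$. For a set $S\subset\mathbb E$, $\Pi_S(x)$ denotes the (unique) point of $S$ nearest to $x$, when it is well defined. $E$ and $\mathcal V$ intersect transversally at $\zeta\in E\cap\mathcal V$ if $\mathrm{codim}(E^0\cap T_\zeta\mathcal V^0)=\mathrm{codim}(E^0)+\mathrm{codim}(T_\zeta\mathcal V^0)$. The open neighborhood $U$ of $\zeta$ is taken small enough that $\Pi_{\mathcal V}$ is well defined and of class $C^2$ on $U$, that $E\cap T_{\Pi_{\mathcal V}(x)}\mathcal V\neq\emptyset$ for $x\in U$ (so that $\varphi$ is well defined on $U$), and that $\mathcal W=E\cap\mathcal V\cap U$ is a manifold of class $C^3$ whose nearest-point projection $\Pi_{\mathcal W}$ is well defined and of class $C^2$ in a neighborhood of $\zeta$; such a neighborhood exists by transversality. *)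

(* Defs.v *)
From HB Require Import structures.
From mathcomp Require Import all_boot all_order all_algebra.
From mathcomp Require Import all_classical all_reals all_analysis.

Set Implicit Arguments.
Unset Strict Implicit.
Unset Printing Implicit Defensive.

Import Order.TTheory GRing.Theory Num.Theory.
Import numFieldNormedType.Exports.

Local Open Scope classical_set_scope.
Local Open Scope ring_scope.

(* A finite-dimensional real vector space whose norm comes from an inner
   product; positive definiteness of dotv follows from dotvv. The library norm
   of 'rV_n is the sup norm, so row vectors are not an instance. *)
HB.mixin Record NormedVector_isEuclidean (R : realType) EE
    of NormedModule R EE & Vector R EE := {
  dotv : EE -> EE -> R;
  dotvC : forall x y, dotv x y = dotv y x;
  dotv_linearl : forall (a : R) x y z,
    dotv (a *: x + y) z = a * dotv x z + dotv y z;
  dotvv : forall x, dotv x x = `|x| ^+ 2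
}.

#[short(type="euclideanType")]
HB.structure Definition Euclidean (R : realType) :=
  {EE of NormedModule R EE & Vector R EE & NormedVector_isEuclidean R EE}.

Section Euclidean_geometry.
Context {R : realType} {EE : euclideanType R}.
Implicit Types (S V E W U O : set EE) (L : {vspace EE}) (x p v : EE).

(* Meant for O open. As EE is finite-dimensional, the differential is of class
   C^k as a map into the linear endomorphisms iff all its evaluations
   x |-> 'd f x v are. *)
Fixpoint class_C (k : nat) O (f : EE -> EE) : Prop :=
  match k with
  | 0 => forall x, O x -> {for x, continuous f}
  | k'.+1 => (forall x, O x -> differentiable f x) /\
             (forall v, class_C k' O (fun x => 'd f x v))
  end.

(* (Phi, Psi) is a C^k diffeomorphism between the open sets O and Phi @` O that
   straightens V to the linear subspace L. *)
Definition slice_chart (k : nat) V O L (Phi Psi : EE -> EE) : Prop :=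
  [/\ open O, open (Phi @` O), class_C k O Phi, class_C k (Phi @` O) Psi &
      forall x, O x -> Psi (Phi x) = x /\ (V x <-> Phi x \in L)].

Definition manifold (k : nat) V : Prop :=
  exists d : nat, forall x, V x -> exists O L Phi Psi,
    [/\ O x, \dim L = d & slice_chart k V O L Phi Psi].

Definition tangent_vectors V x : set EE :=
  [set v | exists c : R -> EE,
     [/\ c 0 = x, \forall t \near (0 : R), V (c t) & is_derive (0 : R) 1 c v]].

(* The linear space T_x V^0. The set of velocities is a linear subspace when x
   belongs to a C^1 manifold V; the value is 0 if that set is not one. *)
Definition tangent V x : {vspace EE} :=
  xget 0%VS [set L : {vspace EE} | [set v | v \in L] = tangent_vectors V x].

Definition affine x L : set EE := [set y | y - x \in L].

Definition affine_tangent V x : set EE := affine x (tangent V x).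

Definition affine_subspace E L : Prop := exists x, E = affine x L.

Definition codim L : nat := (\dim {:EE} - \dim L)%N.

Definition transversal_at V (E0 : {vspace EE}) x : Prop :=
  codim (E0 :&: tangent V x)%VS = (codim E0 + codim (tangent V x))%N.

Definition nearest S x p : Prop :=
  S p /\ forall q, S q -> q <> p -> `|x - p| < `|x - q|.

Definition proj_defined S x : Prop := exists p, nearest S x p.

(* Pi_S; the default value 0 is taken where proj_defined S x fails. *)
Definition nearest_proj S x : EE := xget 0 [set p | nearest S x p].

Definition proj_C (k : nat) S O : Prop :=
  (forall x, O x -> proj_defined S x) /\ class_C k O (nearest_proj S).

Definition proj_C_around (k : nat) S x : Prop :=
  exists O, [/\ open O, O x & proj_C k S O].

Definition phi V E x : EE :=
  nearest_proj (E `&` affine_tangent V (nearest_proj V x)) x.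

Definition phi_defined V E x : Prop :=
  proj_defined V x /\
  proj_defined (E `&` affine_tangent V (nearest_proj V x)) x.

Definition adapted_nbhd V E z U : Prop :=
  [/\ open U /\ U z,
      proj_C 2 V U,
      forall x, U x -> E `&` affine_tangent V (nearest_proj V x) !=set0,
      manifold 3 (E `&` V `&` U) &
      proj_C_around 2 (E `&` V `&` U) z].

End Euclidean_geometry.

(* Main.v *)
(* For x near zeta let w = Pi_W x and e = |x - w|.  Tangent spaces of V vary
   Lipschitz-continuously and V stays quadratically close to them, so by
   transversality the affine space E /\ T_{Pi_V x} V passes at distance O(e^2)
   from w and its direction is O(e)-close to that of T_w W, to which x - w is
   orthogonal.  Hence |phi x - w| <= K e^2.  Both e_i and the increments of
   w_i = Pi_W x_i are then dominated by a geometric sequence, and summing gives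
   |w_i - x_oo| = O(e_i^2), which is at most O(dist(x_i, W)^2).
   An adapted neighbourhood exists because the inverse function theorem provides
   a C^3 chart of E /\ V and inverts its tubular map. *)

From HB Require Import structures.
Require Import Defs.
From mathcomp Require Import all_boot all_order all_algebra.
From mathcomp Require Import all_classical all_reals all_analysis.
From mathcomp Require Import ring lra zify.
Import Order.TTheory GRing.Theory Num.Theory.
Import numFieldNormedType.Exports.
Local Open Scope classical_set_scope.
Local Open Scope ring_scope.

Set Implicit Arguments.
Unset Strict Implicit.
Unset Printing Implicit Defensive.


(** All that the convergence argument knows of V near zeta is packed into the four estimates of
    [local_geometry]; charts serve to establish these and to build an adapted neighbourhood. The
    delicate point is that [x - w] is orthogonal to every direction of [E0 :&: tangent V w], which
    requires actual points of W in each of these directions. Metric regularity supplies them: a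
    point of E at distance d from V lies within O(d) of E /\ V. Its proof and the surjectivity part
    of the inverse function theorem follow one scheme, [halving_iteration], where a defect is halved
    at the price of a move proportional to it. Limits are taken coordinatewise in [halving_cvg], and
    the closedness of E, V and W near zeta is read off from the existence of nearest points. As
    [class_C] speaks of the differential evaluated at fixed vectors, bounds uniform in the direction
    are assembled from the finite orthonormal list [ebasis]. *)

Section InnerProduct.
Context {R : realType} {EE : euclideanType R}.
Implicit Types (x y z v w : EE) (L : {vspace EE}).

(** * Bilinearity of the inner product and Cauchy-Schwarz *)

Lemma dotvDl x y z : dotv (x + y) z = dotv x z + dotv y z.
Proof. by rewrite -[x]scale1r dotv_linearl mul1r scale1r. Qed.

Lemma dotvDr x y z : dotv z (x + y) = dotv z x + dotv z y.
Proof. by rewrite dotvC dotvDl !(dotvC z). Qed.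

Lemma dotv0l x : dotv 0 x = 0.
Proof. by apply: (addrI (dotv 0 x)); rewrite -dotvDl !addr0. Qed.

Lemma dotv0r x : dotv x 0 = 0.
Proof. by rewrite dotvC dotv0l. Qed.

Lemma dotvZl a x z : dotv (a *: x) z = a * dotv x z.
Proof. by rewrite -[a *: x]addr0 dotv_linearl dotv0l addr0. Qed.

Lemma dotvZr a x z : dotv z (a *: x) = a * dotv z x.
Proof. by rewrite dotvC dotvZl dotvC. Qed.

Lemma dotvNl x z : dotv (- x) z = - dotv x z.
Proof. by rewrite -scaleN1r dotvZl mulN1r. Qed.

Lemma dotvNr x z : dotv z (- x) = - dotv z x.
Proof. by rewrite dotvC dotvNl dotvC. Qed.

Lemma dotvBl x y z : dotv (x - y) z = dotv x z - dotv y z.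
Proof. by rewrite dotvDl dotvNl. Qed.

Lemma dotvBr x y z : dotv z (x - y) = dotv z x - dotv z y.
Proof. by rewrite dotvDr dotvNr. Qed.

Lemma dotv_suml (I : Type) (s : seq I) (F : I -> EE) z :
  dotv (\sum_(i <- s) F i) z = \sum_(i <- s) dotv (F i) z.
Proof.
by elim: s => [|i s IH]; rewrite ?big_nil ?dotv0l // !big_cons dotvDl IH.
Qed.

Lemma dotv_sumr (I : Type) (s : seq I) (F : I -> EE) z :
  dotv z (\sum_(i <- s) F i) = \sum_(i <- s) dotv z (F i).
Proof.
by rewrite dotvC dotv_suml; apply: eq_bigr => i _; rewrite dotvC.
Qed.

Lemma normvD2 x y : `|x + y| ^+ 2 = `|x| ^+ 2 + 2 * dotv x y + `|y| ^+ 2.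
Proof. by rewrite -!dotvv dotvDl !dotvDr (dotvC y x); ring. Qed.

Lemma normvB2 x y : `|x - y| ^+ 2 = `|x| ^+ 2 - 2 * dotv x y + `|y| ^+ 2.
Proof. by rewrite normvD2 dotvNr normrN; ring. Qed.

Lemma CauchySchwarzv x y : `|dotv x y| <= `|x| * `|y|.
Proof.
have [->|y0] := eqVneq y 0; first by rewrite dotv0r !normr0 mulr0.
have yp : 0 < `|y| by rewrite normr_gt0.
have H a : 0 <= `|x| ^+ 2 - 2 * a * dotv x y + a ^+ 2 * `|y| ^+ 2.
  have := sqr_ge0 `|x - a *: y|.
  rewrite normvB2 dotvZr normrZ exprMn real_normK ?num_real //.
  by rewrite !mulrA.
have := H (dotv x y / `|y| ^+ 2).
have -> : `|x| ^+ 2 - 2 * (dotv x y / `|y| ^+ 2) * dotv x y +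
  (dotv x y / `|y| ^+ 2) ^+ 2 * `|y| ^+ 2 = `|x| ^+ 2 - dotv x y ^+ 2 / `|y| ^+ 2.
  by field; rewrite gt_eqF.
rewrite subr_ge0 ler_pdivrMr ?exprn_gt0 // -exprMn => K.
rewrite -(ler_pXn2r (n := 2)) ?nnegrE ?mulr_ge0 //.
by rewrite real_normK ?num_real.
Qed.

Lemma dotv_le x y : dotv x y <= `|x| * `|y|.
Proof. exact: le_trans (ler_norm _) (CauchySchwarzv _ _). Qed.

(** Cancels a factor that may vanish; used when a norm is bounded by pairing a vector with
    itself. *)
Lemma ler_sqr_mul (a c : R) : 0 <= a -> 0 <= c -> a ^+ 2 <= c * a -> a <= c.
Proof.
rewrite le_eqVlt => /predU1P[<- // | a0] c0.
by rewrite expr2 ler_pM2r.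
Qed.

(** * Orthonormal lists, orthogonal projections and bounds on linear maps *)

Definition orthonormal (s : seq EE) : Prop :=
  uniq s /\ forall x y, x \in s -> y \in s -> dotv x y = (x == y)%:R.

(** For an orthonormal [s] this is the orthogonal projection onto the span of [s]. *)
Definition expand (s : seq EE) (x : EE) : EE := \sum_(e <- s) dotv x e *: e.

Fact expand_is_linear s : linear (expand s).
Proof.
move=> a x y; rewrite /expand scaler_sumr -big_split /=.
by apply: eq_bigr => e _; rewrite dotv_linearl scalerDl scalerA.
Qed.

HB.instance Definition _ s :=
  GRing.isLinear.Build R EE EE _ (expand s) (@expand_is_linear s).

Lemma expand_span s x : expand s x \in << s >>%VS.
Proof.
rewrite /expand big_seq; apply: rpred_sum => e es.
by rewrite rpredZ // memv_span.
Qed.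

Lemma dotv_expand s x e : orthonormal s -> e \in s ->
  dotv (expand s x) e = dotv x e.
Proof.
move=> [us os] es; rewrite dotv_suml (bigD1_seq e) //= big_seq_cond big1.
  by rewrite dotvZl (os e e) // eqxx mulr1 addr0.
by move=> f /andP[fs fe]; rewrite dotvZl (os f e) // (negPf fe) mulr0.
Qed.

Lemma orthogonal_span s x : (forall e, e \in s -> dotv x e = 0) ->
  forall y, y \in << s >>%VS -> dotv x y = 0.
Proof.
move=> H y /(coord_span (X := in_tuple s)) ->.
rewrite dotv_sumr big1 // => i _.
by rewrite dotvZr H ?mulr0 // mem_nth.
Qed.

Lemma expand_orthogonal s x y : orthonormal s -> y \in << s >>%VS ->
  dotv (x - expand s x) y = 0.
Proof.
move=> os; apply: orthogonal_span => e es.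
by rewrite dotvBl dotv_expand // subrr.
Qed.

Lemma dotvv_eq0 x : dotv x x = 0 -> x = 0.
Proof. by rewrite dotvv => /eqP; rewrite sqrf_eq0 normr_eq0 => /eqP. Qed.

Lemma expand_id s x : orthonormal s -> x \in << s >>%VS -> expand s x = x.
Proof.
move=> os xs; apply/esym/eqP; rewrite -subr_eq0; apply/eqP/dotvv_eq0.
by rewrite expand_orthogonal // rpredB // expand_span.
Qed.

Lemma gram_schmidt (s : seq EE) :
  exists2 t, orthonormal t & << t >>%VS = << s >>%VS.
Proof.
elim: s => [|v s [t ot ts]]; first by exists nil.
set w := v - expand t v.
have wt y : y \in t -> dotv w y = 0.
  by move=> yt; apply: expand_orthogonal => //; exact: memv_span.
(* If [w] vanishes, [v] already lies in the span of [t] and the list is not extended. *)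
have [w0|w0] := eqVneq w 0.
  exists t => //; rewrite span_cons -ts; apply/esym/addv_idPr.
  by rewrite -memvE (subr0_eq w0) expand_span.
have ww : dotv w w != 0 by apply: contraNneq w0 => /dotvv_eq0 ->.
set u := `|w|^-1 *: w.
have nw : `|w| != 0 by rewrite normr_eq0.
have uu : dotv u u = 1.
  by rewrite dotvZl dotvZr dotvv; field.
have ut y : y \in t -> dotv u y = 0.
  by move=> yt; rewrite dotvZl wt // mulr0.
have unt : u \notin t.
  by apply/negP => /ut/eqP; rewrite uu oner_eq0.
exists (u :: t).
  split; first by rewrite /= unt; case: ot.
  move=> x y; rewrite !inE => /orP[/eqP->|xt] /orP[/eqP->|yt].
  - by rewrite uu eqxx.
  - rewrite ut //; case: eqP => // uy; by rewrite uy yt in unt.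
  - rewrite dotvC ut //; case: eqP => // uy; by rewrite -uy xt in unt.
  - by case: ot => _ ->.
rewrite !span_cons -ts.
have -> : v = `|w| *: u + expand t v.
  by rewrite scalerA divff // scale1r subrK.
have et := expand_span t v.
have ev : (<[expand t v]> <= << t >>)%VS by rewrite -memvE.
have -> : (<[u]> = <[`|w| *: u]>)%VS.
  apply/eqP; rewrite eqEsubv -!memvE; apply/andP; split.
    by apply/vlineP; exists (`|w|^-1); rewrite [RHS]scalerA mulVf // scale1r.
  by rewrite rpredZ // memv_line.
apply/eqP; rewrite eqEsubv !subv_add !addvSr !andbT -!memvE.
apply/andP; split; last first.
  by apply: memv_add => //; exact: memv_line.
rewrite -[X in X \in _](addrK (expand t v)) rpredB //.
  by apply: (subvP (addvSl _ _)); exact: memv_line.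
by apply: (subvP (addvSr _ _)).
Qed.

Lemma orthonormal_basis L : exists2 s, orthonormal s & << s >>%VS = L.
Proof.
have [s os ss] := gram_schmidt (vbasis L).
by exists s => //; rewrite ss; exact: (span_basis (vbasisP L)).
Qed.

Definition onb L : seq EE := projT1 (cid2 (orthonormal_basis L)).

Lemma onbP L : orthonormal (onb L).
Proof. by rewrite /onb; case: cid2. Qed.

Lemma span_onb L : <<onb L>>%VS = L.
Proof. by rewrite /onb; case: cid2. Qed.

Definition oproj L : {linear EE -> EE} := expand (onb L).

Lemma oproj_in L x : oproj L x \in L.
Proof. by have := expand_span (onb L) x; rewrite span_onb. Qed.

Lemma oproj_id L x : x \in L -> oproj L x = x.
Proof. by have := @expand_id _ x (onbP L); rewrite span_onb. Qed.

Lemma oproj_orth L x y : y \in L -> dotv (x - oproj L x) y = 0.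
Proof.
by have := @expand_orthogonal _ x y (onbP L); rewrite span_onb; apply.
Qed.

Lemma pythagoras x y : dotv x y = 0 -> `|x + y| ^+ 2 = `|x| ^+ 2 + `|y| ^+ 2.
Proof. by move=> xy; rewrite normvD2 xy mulr0 addr0. Qed.

Lemma norm_oproj L x : `|oproj L x| <= `|x|.
Proof.
rewrite -(ler_pXn2r (n := 2)) ?nnegrE // -[in leRHS](subrK (oproj L x) x).
by rewrite (pythagoras (oproj_orth _ (oproj_in _ _))) lerDr.
Qed.

Definition ebasis : seq EE := onb fullv.

Lemma ebasisE x : \sum_(e <- ebasis) dotv x e *: e = x.
Proof. by rewrite -[LHS]/(oproj fullv x) oproj_id ?memvf. Qed.

Lemma norm_ebasis e : e \in ebasis -> `|e| = 1.
Proof.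
move=> es; have [_ /(_ e e es es)] := onbP fullv.
rewrite dotvv eqxx => /eqP; rewrite sqrf_eq1 => /orP[/eqP // | /eqP e1].
by have := normr_ge0 e; rewrite e1 ler0N1.
Qed.

Lemma linear_sum_ebasis (F : lmodType R) (f : {linear EE -> F}) x :
  f x = \sum_(e <- ebasis) dotv x e *: f e.
Proof.
rewrite -{1}[x]ebasisE linear_sum; apply: eq_bigr => e _.
by rewrite linearZ.
Qed.

(** Finitely many evaluations control the operator norm, because the coordinates of [x] in [ebasis]
    are at most [|x|]. This turns statements about each ['d f x v] into statements uniform in
    [v]. *)
Lemma linear_bound (F : normedModType R) (f : {linear EE -> F}) (c : R) :
  (forall e, e \in ebasis -> `|f e| <= c) ->
  forall x, `|f x| <= (size ebasis)%:R * c * `|x|.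
Proof.
move=> H x; rewrite linear_sum_ebasis.
apply: le_trans (ler_norm_sum _ _ _) _.
have -> : (size ebasis)%:R * c * `|x| = \sum_(e <- ebasis) `|x| * c.
  by rewrite big_const_seq count_predT iter_addr_0 -mulr_natl; ring.
rewrite !big_seq; apply: ler_sum => e es.
rewrite normrZ ler_pM //; last exact: H.
by apply: le_trans (CauchySchwarzv _ _) _; rewrite (norm_ebasis es) mulr1.
Qed.

Lemma linear_bounded (F : normedModType R) (f : {linear EE -> F}) :
  exists2 c, 0 < c & forall x, `|f x| <= c * `|x|.
Proof.
(* The added [1], here and in the factor below, keeps the constant positive for the zero map and for
   the zero space. *)
pose c := 1 + \sum_(e <- ebasis) `|f e|.
have c1 : 1 <= c by rewrite lerDl sumr_ge0.
exists ((1 + size ebasis)%:R * c) => [|x].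
  by rewrite mulr_gt0 ?ltr0n // (lt_le_trans ltr01).
apply: le_trans (linear_bound (c := c) _ x) _ => [e es|].
  rewrite /c (bigD1_seq e) //=; last by case: (onbP fullv).
  by rewrite addrCA lerDl addr_ge0 // sumr_ge0.
by rewrite ler_wpM2r // ler_wpM2r ?ler_nat ?(le_trans ler01).
Qed.

Lemma linear_continuousv (F : normedModType R) (f : {linear EE -> F}) :
  continuous f.
Proof.
have [c c0 fc] := linear_bounded f.
apply/bounded_linear_continuous/linear_boundedP.
exists c; split; first exact: num_real.
move=> M cM x; apply: le_trans (fc x) _.
by rewrite ler_wpM2r // ltW.
Qed.

Lemma injective_linear_surj (f : {linear EE -> EE}) :
  (forall x, f x = 0 -> x = 0) -> forall y, exists x, f x = y.
Proof.
move=> inj y.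
have k0 : lker (linfun f) == 0%VS.
  rewrite -subv0; apply/subvP => x; rewrite memv_ker lfunE /= => /eqP/inj ->.
  exact: mem0v.
exists ((linfun f)^-1%VF y).
by have := lker0_lfunVK k0 y; rewrite lfunE.
Qed.

End InnerProduct.

(** * Sequences controlled by a halving gauge *)

Section Sequences.
Context {R : realType}.

Lemma halving_cvg0 (d : nat -> R) : (forall i, 0 <= d i) ->
  (forall i, d i.+1 <= d i / 2) -> d i @[i --> \oo] --> (0 : R).
Proof.
move=> d0 dS.
have dg i : d i <= geometric (d 0%N) (2^-1) i.
  elim: i => [|i IH]; first by rewrite /geometric /= expr0 mulr1.
  apply: le_trans (dS i) _; rewrite /geometric /= exprS mulrCA mulrC.
  by rewrite ler_wpM2l.
apply: (squeeze_cvgr (f := cst 0) (h := geometric (d 0%N) (2^-1))).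
- by near=> i; rewrite d0 dg.
- exact: cvg_cst.
- by apply: cvg_geometric; rewrite ger0_norm ?invr_ge0 // invf_lt1 // ltr1n.
Unshelve. all: by end_near. Qed.

(** The sequence [u - 2 M d] is nondecreasing and lies below [u + 2 M d], which stays below its
    initial value; so it converges, and [d] tends to 0. *)
Lemma halving_cvg_real (u d : nat -> R) (M : R) : 0 <= M ->
  (forall i, 0 <= d i) -> (forall i, d i.+1 <= d i / 2) ->
  (forall i, `|u i.+1 - u i| <= M * d i) -> cvgn u.
Proof.
move=> M0 d0 dS uS.
have dc := halving_cvg0 d0 dS.
have Md i : M * d i.+1 <= M * d i / 2 by rewrite -mulrA ler_wpM2l.
have a_inc : nondecreasing_seq (fun i => u i - 2 * M * d i).
  apply/nondecreasing_seqP => i.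
  by have := Md i; have := uS i; rewrite ler_norml => /andP[? ?] ?; lra.
have b_dec i : u i + 2 * M * d i <= u 0%N + 2 * M * d 0%N.
  elim: i => // i IH.
  by have := Md i; have := uS i; rewrite ler_norml => /andP[? ?] ?; lra.
have ca : cvgn (fun i => u i - 2 * M * d i).
  apply: nondecreasing_is_cvgn => //.
  exists (u 0%N + 2 * M * d 0%N) => _ [i _ <-].
  have := b_dec i; have : 0 <= M * d i by rewrite mulr_ge0.
  lra.
have -> : u = (fun i => (u i - 2 * M * d i) + 2 * M * d i).
  by apply/funext => i; rewrite subrK.
have /cvg_ex[l cl] := ca.
apply/cvg_ex; exists (l + 2 * M * 0); apply: cvgD => //.
by apply: cvgM => //; exact: cvg_cst.
Qed.

Context {EE : euclideanType R}.
Implicit Types (w : nat -> EE) (x : EE).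

(** The limit is found coordinate by coordinate in [ebasis]; the error bound is the telescoped sum
    of the increments. *)
Lemma halving_cvg w (d : nat -> R) (M : R) : 0 <= M ->
  (forall i, 0 <= d i) -> (forall i, d i.+1 <= d i / 2) ->
  (forall i, `|w i.+1 - w i| <= M * d i) ->
  exists2 l, w i @[i --> \oo] --> l & forall i, `|w i - l| <= 2 * M * d i.
Proof.
move=> M0 d0 dS wS.
have [l wl] : exists l : EE, w i @[i --> \oo] --> l.
  have ce e : e \in ebasis -> cvgn (fun i => dotv (w i) e).
    move=> es; apply: (@halving_cvg_real _ d M) => // i.
    rewrite -dotvBl; apply: le_trans (CauchySchwarzv _ _) _.
    by rewrite (norm_ebasis es) mulr1.
  suff [l sl] : exists l : EE, \sum_(e <- ebasis) dotv (w i) e *: e @[i --> \oo] --> l.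
    exists l; rewrite (_ : w = fun i => \sum_(e <- ebasis) dotv (w i) e *: e) //.
    by apply/funext => i; rewrite ebasisE.
  elim: ebasis ce => [_|e s IH ce].
    by exists 0; under eq_cvg do rewrite big_nil; exact: cvg_cst.
  have [|l sl] := IH; first by move=> f fs; apply: ce; rewrite inE fs orbT.
  have /cvg_ex[k ek] := ce e (mem_head e s).
  exists (k *: e + l); under eq_cvg do rewrite big_cons.
  by apply: cvgD => //; exact: cvgZr_tmp.
exists l => // i.
(* Subtracting [d (i + k)] makes the induction close: an increment [M d] is at most [2 M (d - d')]
   when [d' <= d / 2]. *)
have H k : `|w i - w (i + k)%N| <= 2 * M * (d i - d (i + k)%N).
  elim: k => [|k IH]; first by rewrite addn0 !subrr normr0 mulr0.
  rewrite addnS -(subrKA (w (i + k)%N)); apply: le_trans (ler_normD _ _) _.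
  have : M * d (i + k).+1 <= M * d (i + k)%N / 2 by rewrite -mulrA ler_wpM2l.
  have := wS (i + k)%N; rewrite distrC; lra.
have cl : `|w i - w (k + i)%N| @[k --> \oo] --> `|w i - l|.
  apply: cvg_norm; apply: cvgB; first exact: cvg_cst.
  by rewrite (cvg_shiftn i w).
apply: (cvgr_to_le cl); near=> k.
rewrite addnC; apply: le_trans (H k) _.
by rewrite ler_wpM2l ?mulr_ge0 // gerBl.
Unshelve. all: by end_near. Qed.

(** [P x d] is to be read as: the defect of [x] is at most [d]. The moves sum to at most
    [2 C d0 < rho], so the step hypothesis stays applicable. Since [P] need not be closed, the
    conclusion only offers approximants of [w] with arbitrarily small defect, and each user passes
    to the limit in its own way. *)
Lemma halving_iteration (P : EE -> R -> Prop) x0 (d0 rho C : R) :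
  0 <= C -> 0 <= d0 -> 2 * C * d0 < rho -> P x0 d0 ->
  (forall x d, 0 <= d <= d0 -> `|x - x0| < rho -> P x d ->
    exists2 x', P x' (d / 2) & `|x' - x| <= C * d) ->
  exists2 w, `|w - x0| <= 2 * C * d0 &
    forall eps : R, 0 < eps ->
      exists x d, [/\ `|x - w| < eps, 0 <= d < eps, d <= d0 & P x d].
Proof.
move=> C0 d00 Crho P0 step.
(* The premises of a step are moved under the existential so that choice yields a total map. *)
have /choice[f fP] : forall xd : EE * R, exists x', 0 <= xd.2 <= d0 ->
    `|xd.1 - x0| < rho -> P xd.1 xd.2 ->
    P x' (xd.2 / 2) /\ `|x' - xd.1| <= C * xd.2.
  move=> [x d] /=.
  have [[h1 [h2 h3]]|N] := pselect (0 <= d <= d0 /\ `|x - x0| < rho /\ P x d).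
    by have [x' h4 h5] := step x d h1 h2 h3; exists x'.
  by exists x => h1 h2 h3; exfalso; apply: N.
pose d i := d0 / 2 ^+ i.
have dS i : d i.+1 = d i / 2 by rewrite /d exprS; field; rewrite expf_neq0.
have dge i : 0 <= d i by rewrite divr_ge0 // exprn_ge0.
have dle i : d i <= d0.
  elim: i => [|i IH]; first by rewrite /d expr0 divr1.
  by rewrite dS; have := dge i; lra.
pose X := fix X i := if i is j.+1 then f (X j, d j) else x0.
have inv i : P (X i) (d i) /\ `|X i - x0| <= 2 * C * (d0 - d i).
  elim: i => [|i [Pi Xi]].
    by rewrite /X /d expr0 divr1 !subrr normr0 mulr0.
  have lrho : `|X i - x0| < rho.
    apply: le_lt_trans Crho; apply: le_trans Xi _.
    by rewrite ler_wpM2l ?mulr_ge0 // gerBl.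
  have [|P' X'] := fP (X i, d i) _ lrho Pi; first by rewrite /= dge dle.
  split; first by rewrite dS.
  rewrite -(subrKA (X i)); apply: le_trans (ler_normD _ _) _.
  rewrite dS; rewrite /= in X'; lra.
have XS i : `|X i.+1 - X i| <= C * d i.
  have [Pi Xi] := inv i.
  have lrho : `|X i - x0| < rho.
    apply: le_lt_trans Crho; apply: le_trans Xi _.
    by rewrite ler_wpM2l ?mulr_ge0 // gerBl.
  by have [|_ ->] := fP (X i, d i) _ lrho Pi; first by rewrite /= dge dle.
have dS' i : d i.+1 <= d i / 2 by rewrite dS.
have [w Xw dw] := halving_cvg C0 dge dS' XS.
exists w => [|eps eps0].
  by rewrite distrC; have := dw 0%N; rewrite /d expr0 divr1.
have dc := halving_cvg0 dge dS'.
have : \forall i \near \oo, `|w - X i| < eps /\ `|0 - d i| < eps.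
  by near=> i; split; near: i; exact: cvgr_dist_lt.
case=> N _ /(_ N (leqnn N)) /= [h1]; rewrite sub0r normrN ger0_norm // => h2.
exists (X N), (d N); split => //; first by rewrite distrC.
  by rewrite dge.
by have [] := inv N.
Unshelve. all: by end_near. Qed.
End Sequences.

(** * Differentials, the mean value inequality and a basic product *)

Section Calculus.
Context {R : realType} {EE : euclideanType R}.
Implicit Types (f g h : EE -> EE) (x y z v w p : EE) (O : set EE).

Lemma differentiable_epsP f x : differentiable f x ->
  forall eps : R, 0 < eps ->
    \forall y \near x, `|f y - f x - 'd f x (y - x)| <= eps * `|y - x|.
Proof.
move=> /diff_locallyP[_ /eqaddoP H] eps e0.
have /nbhs_ballP[d /= d0 Hd] := H eps e0.
apply/nbhs_ballP; exists d => //= y; rewrite -ball_normE /= => xy.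
have := Hd (y - x).
rewrite -ball_normE /= sub0r normrN distrC => /(_ xy).
by rewrite !fctE /= subrK opprD addrA.
Qed.

(** Gives differentiability and the value of the differential at once, by uniqueness of the
    first-order expansion; this is how the differentials of inverse maps are computed below. *)
Lemma eps_differentiable f x (A : {linear EE -> EE}) :
  (forall eps : R, 0 < eps ->
    \forall y \near x, `|f y - f x - A (y - x)| <= eps * `|y - x|) ->
  differentiable f x /\ 'd f x = A :> (EE -> EE).
Proof.
move=> H.
have cA : continuous A by exact: linear_continuousv.
have E : f \o shift x = cst (f x) + A +o_ (0 : EE) id.
  apply/eqaddoP => eps e0.
  have /nbhs_ballP[d /= d0 Hd] := H eps e0.
  apply/nbhs_ballP; exists d => //= y; rewrite -ball_normE /= sub0r normrN => yd.
  have := Hd (y + x).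
  rewrite -ball_normE /= opprD addrCA subrr addr0 normrN => /(_ yd).
  by rewrite !fctE /= addrK opprD addrA.
have dE := diff_unique cA E.
split=> //; apply/diff_locallyP; rewrite dE; split => //.
Qed.

Lemma differentiable_near_eq f g x : (\forall y \near x, f y = g y) ->
  differentiable f x -> differentiable g x /\ 'd g x = 'd f x :> (EE -> EE).
Proof.
move=> fg df; apply: eps_differentiable => eps e0.
have fgx := nbhs_singleton fg.
have := differentiable_epsP df e0; apply: filterS2 fg => y -> .
by rewrite fgx.
Qed.

Definition dotl w : EE -> R := fun x => dotv x w.

Fact dotl_is_linear w : linear (dotl w).
Proof. by move=> a x y; rewrite /dotl dotv_linearl. Qed.

HB.instance Definition _ w :=
  GRing.isLinear.Build R EE R^o _ (dotl w) (@dotl_is_linear w).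

Lemma is_diff_line x w (t : R) :
  is_diff t (fun s : R => x + s *: w) ( *:%R^~ w).
Proof.
rewrite (_ : (fun s : R => _) = cst x + *:%R^~ w) //.
by apply: is_diff_eq; rewrite add0r.
Qed.

(** Pairing with [w = f y - f x] reduces to the real mean value theorem: [|w|^2] equals a derivative
    bounded by [M |w|], and one factor cancels. *)
Lemma mean_value_le f x y (M : R) :
  (forall t : R, 0 <= t <= 1 -> differentiable f (x + t *: (y - x)) /\
     `|'d f (x + t *: (y - x)) (y - x)| <= M) ->
  `|f y - f x| <= M.
Proof.
move=> H.
set w := f y - f x.
pose s (t : R) := x + t *: (y - x).
pose g (t : R) := dotv (f (s t)) w.
pose g' (t : R) := dotv ('d f (s t) (y - x)) w.
have ds t : is_diff t s ( *:%R^~ (y - x)) by exact: is_diff_line.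
have dg (t : R) : 0 <= t <= 1 -> is_derive t 1 g (g' t).
  move=> t01; have [df _] := H t t01.
  have dw : differentiable (dotl w) (f (s t)).
    by apply: linear_differentiable; exact: linear_continuousv.
  have dfs : differentiable (f \o s) t by apply: differentiable_comp.
  have dgt : differentiable (dotl w \o (f \o s)) t by exact: differentiable_comp.
  split; first exact/derivable1_diffP.
  rewrite (deriveE _ dgt) diff_comp //= diff_comp //= diff_lin; last exact: linear_continuousv.
  by rewrite (diff_val (is_diff_def := ds t)) scale1r.
have M0 : 0 <= M by have [|_] := H 0; [lra|exact: le_trans].
have [c c01] : exists2 c, c \in `]0, 1[%R & g 1 - g 0 = g' c * (1 - 0).
  apply: MVT; first exact: ltr01.
    by move=> t; rewrite in_itv /= => /andP[? ?]; apply: dg; lra.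
  apply: derivable_within_continuous => t; rewrite in_itv /= => t01.
  by have [] := dg t t01.
have s1 : s 1 = y by rewrite /s scale1r addrC subrK.
have s0 : s 0 = x by rewrite /s scale0r addr0.
rewrite /g /g' subr0 mulr1 -dotvBl s1 s0 -/w dotvv => E.
apply: ler_sqr_mul => //; rewrite E.
apply: le_trans (dotv_le _ _) _; rewrite ler_wpM2r //.
have [|_] := H c _; last exact.
by move: c01; rewrite in_itv /= => /andP[? ?]; lra.
Qed.

Lemma ball_segment p (r t : R) x y : ball p r x -> ball p r y -> 0 <= t <= 1 ->
  ball p r (x + t *: (y - x)).
Proof.
have -> : x + t *: (y - x) = (1 - t) *: x + t *: y.
  by rewrite scalerBr scalerBl scale1r addrA addrAC.
rewrite -!ball_normE /= => px py /andP[t0 t1].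
have -> : p - ((1 - t) *: x + t *: y) = (1 - t) *: (p - x) + t *: (p - y).
  by rewrite !scalerBr addrACA -scalerDl subrK scale1r -opprD.
apply: le_lt_trans (ler_normD _ _) _; rewrite !normrZ.
rewrite (ger0_norm t0) ger0_norm ?subr_ge0 //.
(* Strictness comes from the term with factor [1 - t], so [t = 1] is treated apart. *)
have [t10|t10] := ltP t 1; last first.
  by rewrite (_ : t = 1) ?subrr ?mul0r ?add0r ?mul1r //; apply/le_anti/andP.
have : (1 - t) * `|p - x| < (1 - t) * r by rewrite ltr_pM2l ?subr_gt0.
have : t * `|p - y| <= t * r by rewrite ler_wpM2l // ltW.
lra.
Qed.

(** The mean value inequality for [f - A]. Asking for a bound only along the segment and in its
    direction lets [M] depend on [x] and [y], as the quadratic Taylor estimate needs. *)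
Lemma mean_value_ball_linear f (A : {linear EE -> EE}) p (r M : R) x y :
  (forall z, ball p r z -> differentiable f z) -> ball p r x -> ball p r y ->
  (forall t : R, 0 <= t <= 1 ->
    `|'d f (x + t *: (y - x)) (y - x) - A (y - x)| <= M) ->
  `|f y - f x - A (y - x)| <= M.
Proof.
move=> df px py bf.
pose g := f - (A : EE -> EE).
have -> : f y - f x - A (y - x) = g y - g x.
  by rewrite /g !fctE linearB /= !opprB [A x - A y]addrC addrACA [- f x + _]addrC.
apply: mean_value_le => t t01.
have pt := ball_segment px py t01.
have cA : continuous A by exact: linear_continuousv.
have dA z : differentiable A z by exact: linear_differentiable.
have dfz := df _ pt.
split; first exact: differentiableB.
rewrite (diffB dfz (dA _)) (diff_lin _ cA); exact: bf t t01.
Qed.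

Lemma mean_value_ball f (A : {linear EE -> EE}) p (r M : R) :
  (forall z, ball p r z -> differentiable f z) ->
  (forall z v, ball p r z -> `|'d f z v - A v| <= M * `|v|) ->
  forall x y, ball p r x -> ball p r y ->
    `|f y - f x - A (y - x)| <= M * `|y - x|.
Proof.
move=> df bf x y px py; apply: (mean_value_ball_linear df px py) => t t01.
exact: bf (ball_segment px py t01).
Qed.

Lemma near_seq (s : seq EE) (P : EE -> EE -> Prop) p :
  (forall e, e \in s -> \forall x \near p, P e x) ->
  \forall x \near p, forall e, e \in s -> P e x.
Proof.
elim: s => [|a s IH] H; first by near=> x.
have H1 : \forall x \near p, forall e, e \in s -> P e x.
  by apply: IH => e es; apply: H; rewrite inE es orbT.
have H2 := H a (mem_head _ _).
by apply: filterS2 H1 H2 => x h1 h2 e; rewrite inE => /orP[/eqP->|/h1].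
Unshelve. all: by end_near. Qed.

(** In finite dimension pointwise continuity of a family of linear maps is continuity in operator
    norm. *)
Lemma linear_family_near (A : EE -> {linear EE -> EE}) p :
  (forall v, {for p, continuous (fun x => A x v)}) ->
  forall eps : R, 0 < eps ->
    \forall x \near p, forall v, `|A x v - A p v| <= eps * `|v|.
Proof.
move=> cA eps e0.
pose n := size (ebasis (EE := EE)).
have c0 : 0 < eps / n.+1%:R by rewrite divr_gt0.
have : \forall x \near p, forall e, e \in ebasis -> `|A p e - A x e| < eps / n.+1%:R.
  apply: near_seq => e es.
  exact: (cvgr_dist_lt _ _ (cA e) _ c0).
apply: filterS => x H v.
have := @linear_bound _ _ _ (A x \- A p) (eps / n.+1%:R) _ v.
rewrite /=; move=> K; apply: le_trans (K _) _ => [e es|].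
  by rewrite distrC ltW // H.
rewrite ler_wpM2r // mulrA ler_pdivrMr // mulrC ler_wpM2l ?ltW //.
by rewrite ltr_nat.
Qed.

(** The one product whose differential has to be known: expanding the argument in [ebasis] writes
    [A x (g x)] as a sum of terms [dotscale e (g x) (A x e)]. *)
Definition dotscale e (u w : EE) : EE := dotv u e *: w.

Fact dotscale_is_bilinear e :
  bilinear_for
    (GRing.Scale.Law.clone _ _ *:%R _) (GRing.Scale.Law.clone _ _ *:%R _)
    (dotscale e).
Proof.
split=> [u'|u] a x y /=; rewrite /dotscale.
- by rewrite dotv_linearl scalerDl scalerA.
- by rewrite scalerDr !scalerA mulrC.
Qed.

HB.instance Definition _ e :=
  bilinear_isBilinear.Build R EE EE EE _ _ (dotscale e)
    (dotscale_is_bilinear e).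

Lemma dotv_continuous e : continuous (fun x => dotv x e).
Proof. have H : continuous (dotl e) by apply: linear_continuousv. exact: H. Qed.

Lemma dotscale_diff e f g x : differentiable f x -> differentiable g x ->
  differentiable (fun z => dotv (f z) e *: g z) x /\
  'd (fun z => dotv (f z) e *: g z) x =
    (fun v => dotv (f x) e *: 'd g x v + dotv ('d f x v) e *: g x) :> (EE -> EE).
Proof.
move=> df dg.
have cD (p : EE * EE) : {for p, continuous (fun q => dotscale e q.1 q.2)}.
  apply: cvgZ; last exact: cvg_snd.
  apply: (cvg_comp fst (fun u => dotv u e)); [exact: cvg_fst|exact: dotv_continuous].
have dp := differentiable_pair df dg.
have db (p : EE * EE) : differentiable (fun q => dotscale e q.1 q.2) p.
  by apply: differentiable_bilin => q; exact: cD.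
have -> : (fun z => dotv (f z) e *: g z) =
  (fun q => dotscale e q.1 q.2) \o (fun z => (f z, g z)) by [].
split; first exact: differentiable_comp.
rewrite (diff_comp dp (db _)) diff_bilin; last by move=> q; exact: cD.
by rewrite (diff_pair df dg).
Qed.

End Calculus.

(** * Closure properties of [class_C] *)

Section ClassC.
Context {R : realType} {EE : euclideanType R}.
Implicit Types (f g h K : EE -> EE) (x y z v w p : EE) (O : set EE) (k : nat).

Lemma class_C_continuous k O f x : class_C k O f -> O x -> {for x, continuous f}.
Proof.
case: k => [|k] /=; first by move=> H /H.
by move=> [H _] /H; exact: differentiable_continuous.
Qed.

Lemma class_CW k O f : class_C k.+1 O f -> class_C k O f.
Proof.
elim: k f => [|k IH] f; first by move=> Cf x; exact: class_C_continuous Cf.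
by move=> [df Cf]; split => // v; exact/IH/Cf.
Qed.

Lemma class_C_leq m k O f : (m <= k)%N -> class_C k O f -> class_C m O f.
Proof.
move=> /subnK <-; elim: (k - m)%N => // j IH.
by rewrite addSn => /class_CW.
Qed.

Lemma class_C_subset k O O' f : O' `<=` O -> class_C k O f -> class_C k O' f.
Proof.
move=> sub; elim: k f => [|k IH] f /=; first by move=> H x /sub/H.
by move=> [df Cf]; split => [x /sub/df //|v]; exact/IH/Cf.
Qed.

Lemma class_CS k O f : (forall x, O x -> differentiable f x) ->
  (forall v, class_C k O (fun x => 'd f x v)) -> class_C k.+1 O f.
Proof. by []. Qed.

Lemma class_C_differentiable k O f x : class_C k.+1 O f -> O x ->
  differentiable f x.
Proof. by move=> [H _]; exact: H. Qed.

Lemma class_C_diff k O f v : class_C k.+1 O f -> class_C k O (fun x => 'd f x v).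
Proof. by move=> [_]; exact. Qed.

Lemma class_C_eq k O f g : open O -> (forall x, O x -> f x = g x) ->
  class_C k O f -> class_C k O g.
Proof.
move=> oO; elim: k f g => [|k IH] f g fg.
  move=> Cf x Ox; have fgx : \forall y \near x, f y = g y.
    by apply: filterS (open_nbhs_nbhs (conj oO Ox)) => y /fg.
  rewrite /prop_for /continuous_at -(fg _ Ox).
  by apply: cvg_trans (Cf x Ox); exact: near_eq_cvg.
have fgx x : O x -> \forall y \near x, f y = g y.
  by move=> Ox; apply: filterS (open_nbhs_nbhs (conj oO Ox)) => y /fg.
move=> Cf; apply: class_CS => [x Ox|v].
  exact: (differentiable_near_eq (fgx x Ox) (class_C_differentiable Cf Ox)).1.
apply: IH (class_C_diff v Cf) => x Ox; apply/esym.
have E := (differentiable_near_eq (fgx x Ox) (class_C_differentiable Cf Ox)).2.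
exact: (congr1 (fun h : EE -> EE => h v) E).
Qed.

Lemma class_C_cst k O (c : EE) : class_C k O (fun _ => c).
Proof.
elim: k c => [|k IH] c /=; first by move=> x _; exact: cst_continuous.
split=> [x _|v]; first exact: differentiable_cst.
rewrite (_ : (fun x => _) = fun=> 0); first exact: IH.
by apply/funext => x; rewrite diff_cst.
Qed.

Lemma class_C_linear k O (A : {linear EE -> EE}) : class_C k O A.
Proof.
have cA : continuous A by exact: linear_continuousv.
case: k => [|k] /=; first by move=> x _; exact: cA.
split=> [x _|v]; first exact: linear_differentiable.
rewrite (_ : (fun x => _) = fun=> A v); first exact: class_C_cst.
by apply/funext => x; rewrite diff_lin.
Qed.

Lemma class_C_add k O f g : open O -> class_C k O f -> class_C k O g ->
  class_C k O (fun x => f x + g x).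
Proof.
move=> oO; elim: k f g => [|k IH] f g Cf Cg.
  by move=> x Ox; apply: cvgD; [exact: Cf|exact: Cg].
apply: class_CS => [x Ox|v].
  by apply: differentiableD; apply: class_C_differentiable; eassumption.
apply: (class_C_eq oO _ (IH _ _ (class_C_diff v Cf) (class_C_diff v Cg))).
move=> x Ox; apply/esym.
have E := diffD (class_C_differentiable Cf Ox) (class_C_differentiable Cg Ox).
exact: (congr1 (fun h : EE -> EE => h v) E).
Qed.

Lemma class_C_dotscale k O e f g : open O -> class_C k O f -> class_C k O g ->
  class_C k O (fun x => dotv (f x) e *: g x).
Proof.
move=> oO; elim: k f g => [|k IH] f g Cf Cg.
  move=> x Ox; apply: cvgZ; last exact: Cg.
  by apply: (cvg_comp f (fun u => dotv u e)); [exact: Cf|exact: dotv_continuous].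
have dfg x (Ox : O x) := dotscale_diff e (class_C_differentiable Cf Ox)
  (class_C_differentiable Cg Ox).
apply: class_CS => [x Ox|v]; first exact: (dfg x Ox).1.
have C1 := IH _ _ (class_CW Cf) (class_C_diff v Cg).
have C2 := IH _ _ (class_C_diff v Cf) (class_CW Cg).
apply: (class_C_eq oO _ (class_C_add oO C1 C2)) => x Ox; apply/esym.
exact: (congr1 (fun h : EE -> EE => h v) (dfg x Ox).2).
Qed.

Lemma class_C_sum k O (s : seq EE) (F : EE -> EE -> EE) : open O ->
  (forall e, class_C k O (F e)) -> class_C k O (fun x => \sum_(e <- s) F e x).
Proof.
move=> oO CF; elim: s => [|e s IH].
  by apply: (class_C_eq (f := fun=> 0)) => //; [move=> x _; rewrite big_nil|exact: class_C_cst].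
apply: (class_C_eq (f := fun x => F e x + \sum_(e <- s) F e x)) => //.
  by move=> x _; rewrite big_cons.
exact: class_C_add.
Qed.

Lemma class_C_app k O (A : EE -> {linear EE -> EE}) g : open O ->
  (forall v, class_C k O (fun x => A x v)) -> class_C k O g ->
  class_C k O (fun x => A x (g x)).
Proof.
move=> oO CA Cg.
apply: (class_C_eq (f := fun x => \sum_(e <- ebasis) dotv (g x) e *: A x e)) => //.
  by move=> x _; rewrite -linear_sum_ebasis.
by apply: class_C_sum => // e; exact: class_C_dotscale.
Qed.

(** By the chain rule the derivative is the family ['d f (K y)] applied to ['d K y v]. The induction
    hypothesis handles the family at a fixed vector, and [class_C_app] then lets the vector vary
    with [y]. *)
Lemma class_C_comp k O O' f K : open O -> open O' ->
  (forall y, O' y -> O (K y)) -> class_C k O f -> class_C k O' K ->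
  class_C k O' (fun y => f (K y)).
Proof.
move=> oO oO' KO; elim: k f => [|k IH] f.
  move=> /= Cf CK y Oy; apply: continuous_comp; first exact: CK.
  exact/Cf/KO.
move=> Cf CK.
have df y (Oy : O' y) := class_C_differentiable Cf (KO y Oy).
have dK y (Oy : O' y) := class_C_differentiable CK Oy.
apply: class_CS => [y Oy|v].
  exact: differentiable_comp (dK y Oy) (df y Oy).
have C1 w := IH _ (class_C_diff w Cf) (class_CW CK).
have C2 := @class_C_app k O' (fun y => 'd f (K y)) _ oO' C1 (class_C_diff v CK).
apply: (class_C_eq oO' _ C2) => y Oy; apply/esym.
exact: (congr1 (fun h : EE -> EE => h v) (diff_comp (dK y Oy) (df y Oy))).
Qed.

End ClassC.

(** * Uniform local estimates for maps of class C^1 and C^2 *)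

Section LocalEstimates.
Context {R : realType} {EE : euclideanType R}.
Implicit Types (f g h K : EE -> EE) (x y z v w p : EE) (O : set EE) (k : nat).

Lemma ball_subset_min p (r s : R) :
  ball p (Num.min r s) `<=` ball p r /\ ball p (Num.min r s) `<=` ball p s.
Proof. by split; apply: le_ball; rewrite ge_min lexx ?orbT. Qed.

Lemma class_C1_near k O f p (eps : R) : open O -> O p -> class_C k.+1 O f ->
  0 < eps -> exists2 r : R, 0 < r & ball p r `<=` O /\
    forall z v, ball p r z -> `|'d f z v - 'd f p v| <= eps * `|v|.
Proof.
move=> oO Op Cf e0.
have cA v : {for p, continuous (fun x => 'd f x v)}.
  exact: class_C_continuous (class_C_diff v Cf) Op.
have /nbhs_ballP[r r0 Hr] := linear_family_near (A := fun x => 'd f x) cA e0.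
have /nbhs_ballP[s s0 Hs] := open_nbhs_nbhs (conj oO Op).
have [h1 h2] := ball_subset_min p r s.
exists (Num.min r s); first by rewrite lt_min r0 s0.
by split=> [z /h2/Hs //|z v /h1/Hr]; exact.
Qed.

Lemma class_C1_lipschitz k O f p : open O -> O p -> class_C k.+1 O f ->
  exists r C : R, [/\ 0 < r, 0 < C, ball p r `<=` O &
    (forall z v, ball p r z -> `|'d f z v| <= C * `|v|) /\
    (forall x y, ball p r x -> ball p r y -> `|f y - f x| <= C * `|y - x|)].
Proof.
move=> oO Op Cf.
have [r r0 [rO Hr]] := class_C1_near oO Op Cf ltr01.
have [c c0 Hc] := linear_bounded ('d f p).
have D z v : ball p r z -> `|'d f z v| <= (1 + c) * `|v|.
  move=> pz; rewrite -['d f z v](subrK ('d f p v)) mulrDl.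
  by apply: le_trans (ler_normD _ _) _; rewrite lerD ?Hr.
exists r, (1 + c); split => //; first by rewrite addr_gt0.
split=> // x y px py; apply: mean_value_le => t t01.
have pt := ball_segment px py t01.
by split; [exact: class_C_differentiable Cf (rO _ pt)|exact: D].
Qed.

Lemma uniform_constants (s : seq EE) (Q : EE -> R -> R -> Prop) :
  (forall e r C r' C', Q e r C -> r' <= r -> C <= C' -> Q e r' C') ->
  (forall e, exists r C : R, [/\ 0 < r, 0 < C & Q e r C]) ->
  exists r C : R, [/\ 0 < r, 0 < C & forall e, e \in s -> Q e r C].
Proof.
move=> mono H; elim: s => [|a s [r [C [r0 C0 IH]]]].
  by exists 1, 1; split.
have [r' [C' [r'0 C'0 Q']]] := H a.
exists (Num.min r r'), (Num.max C C'); split.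
- by rewrite lt_min r0.
- by rewrite lt_max C0.
move=> e; rewrite inE => /orP[/eqP->|es].
  by apply: mono Q' _ _; rewrite ?ge_min ?le_max lexx orbT.
by apply: mono (IH _ es) _ _; rewrite ?ge_min ?le_max lexx.
Qed.

Definition taylor_bounds (U : set EE) f (C : R) : Prop :=
  [/\ forall x, U x -> differentiable f x,
      forall x v, U x -> `|'d f x v| <= C * `|v|,
      forall x y, U x -> U y -> `|f y - f x| <= C * `|y - x|,
      forall x y v, U x -> U y -> `|'d f y v - 'd f x v| <= C * `|y - x| * `|v| &
      forall x y, U x -> U y ->
        `|f y - f x - 'd f x (y - x)| <= C * `|y - x| ^+ 2].

(** Each map ['d f x e] with [e] in [ebasis] is C^1, hence locally Lipschitz; common constants make
    the whole differential Lipschitz, and the mean value inequality integrates this to second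
    order. *)
Lemma class_C2_taylor k O f p : open O -> O p -> class_C k.+2 O f ->
  exists r C : R, [/\ 0 < r, 0 < C, ball p r `<=` O &
    taylor_bounds (ball p r) f C].
Proof.
move=> oO Op Cf.
have [r1 [C1 [r10 C10 r1O [D1 L1]]]] := class_C1_lipschitz oO Op Cf.
pose Q e (r C : R) := forall x y, ball p r x -> ball p r y ->
  `|'d f y e - 'd f x e| <= C * `|y - x|.
have [|e|r2 [C2 [r20 C20 HQ]]] := @uniform_constants ebasis Q.
- move=> e r C r' C' q rr CC x y px py.
  apply: le_trans (q _ _ (le_ball rr px) (le_ball rr py)) _.
  by rewrite ler_wpM2r.
- have [r [C [r0 C0 _ [_ L]]]] := class_C1_lipschitz oO Op (class_C_diff e Cf).
  by exists r, C.
have [h1 h2] := ball_subset_min p r1 r2.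
set r := Num.min r1 r2 in h1 h2 *.
pose n : R := (size (ebasis (EE := EE)))%:R.
have n0 : 0 <= n by exact: ler0n.
have dL x y v : ball p r x -> ball p r y ->
    `|'d f y v - 'd f x v| <= (n * C2) * `|y - x| * `|v|.
  move=> px py.
  have := @linear_bound _ _ _ ('d f y \- 'd f x) (C2 * `|y - x|) _ v.
  rewrite /= -/n !mulrA; apply => e es.
  by apply: (HQ e es); exact: h2.
have df x : ball p r x -> differentiable f x.
  by move=> /h1/r1O; exact: class_C_differentiable Cf.
exists r, (C1 + n * C2); split.
- by rewrite lt_min r10.
- by rewrite ltr_wpDr // mulr_ge0 // ltW.
- by move=> z /h1/r1O.
have nC : 0 <= n * C2 by rewrite mulr_ge0 // ltW.
split=> //.
- move=> x v /h1 px; apply: le_trans (D1 _ _ px) _.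
  by rewrite ler_wpM2r // lerDl.
- move=> x y /h1 px /h1 py; apply: le_trans (L1 _ _ px py) _.
  by rewrite ler_wpM2r // lerDl.
- move=> x y v px py; apply: le_trans (dL _ _ _ px py) _.
  by rewrite !ler_wpM2r // lerDr ltW.
move=> x y px py.
apply: (mean_value_ball_linear df px py) => t t01.
apply: le_trans (dL _ _ _ px (ball_segment px py t01)) _.
rewrite [x + _]addrC addrK normrZ expr2 !mulrA.
case/andP: t01 => t0 t1; rewrite !ler_wpM2r //.
rewrite ger0_norm // -[leRHS]mulr1 ler_pM // lerDr ltW //.
Qed.

End LocalEstimates.

(** * Smoothness of the inverse of a family of linear maps *)

Section InverseFunction.
Context {R : realType} {EE : euclideanType R}.
Implicit Types (f g h H K : EE -> EE) (x y z u v w p : EE) (O : set EE) (k : nat).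

(** Needed where [w] itself moves with [y]: the right-hand side separates the coordinates of [w]
    from the derivatives of the family. *)
Lemma diff_linear_family (A : EE -> {linear EE -> EE}) y w u :
  (forall e, differentiable (fun z => A z e) y) ->
  'd (fun z => A z w) y u =
    \sum_(e <- ebasis) dotv w e *: 'd (fun z => A z e) y u.
Proof.
move=> dA.
have -> : (fun z => A z w) = (fun z => \sum_(e <- ebasis) dotv w e *: A z e).
  by apply/funext => z; rewrite -linear_sum_ebasis.
suff [] : differentiable (fun z => \sum_(e <- ebasis) dotv w e *: A z e) y /\
  'd (fun z => \sum_(e <- ebasis) dotv w e *: A z e) y u =
    \sum_(e <- ebasis) dotv w e *: 'd (fun z => A z e) y u by [].
elim: ebasis => [|e s [IH1 IH2]].
  rewrite (_ : (fun z => _) = cst 0); last first.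
    by apply/funext => z; rewrite big_nil.
  by rewrite diff_cst big_nil; split => //; exact: differentiable_cst.
rewrite (_ : (fun z => _) = (dotv w e *: (fun z => A z e)) +
  (fun z => \sum_(e <- s) dotv w e *: A z e)); last first.
  by apply/funext => z; rewrite big_cons.
have d1 : differentiable (dotv w e *: (fun z => A z e)) y.
  exact: differentiableZ.
split; first exact: differentiableD.
have E1 := congr1 (fun h : EE -> EE => h u) (diffD d1 IH1).
have E2 := congr1 (fun h : EE -> EE => h u) (diffZ (dotv w e) (dA e)).
rewrite E1 big_cons -IH2; congr (_ + _); exact: E2.
Qed.

(** Near [p] the map [A y] is within [1 / (2 c)] of [A p], where [c] bounds [B p]; half of [|B y v|]
    is then absorbed on the left. *)
Lemma inverse_family_bound (A B : EE -> {linear EE -> EE}) p :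
  (forall v, {for p, continuous (fun x => A x v)}) ->
  (forall v, B p (A p v) = v) ->
  (\forall y \near p, forall v, A y (B y v) = v) ->
  exists2 c : R, 0 < c & \forall y \near p, forall v, `|B y v| <= c * `|v|.
Proof.
move=> cA BA AB.
have [c c0 Bc] := linear_bounded (B p).
have e0 : 0 < (2 * c)^-1 by rewrite invr_gt0 mulr_gt0.
exists (2 * c); first by rewrite mulr_gt0.
have := linear_family_near cA e0; apply: filterS2 AB => y AB Ay v.
have h1 : `|B y v| <= c * `|A p (B y v)| by rewrite -{1}[B y v]BA Bc.
have h2 := Ay (B y v); rewrite AB in h2.
have h3 : `|A p (B y v)| <= `|v| + (2 * c)^-1 * `|B y v|.
  rewrite -[A p _](subrK v) addrC; apply: le_trans (ler_normD _ _) _.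
  by rewrite lerD2l distrC.
have : c * `|A p (B y v)| <= c * `|v| + 2^-1 * `|B y v|.
  apply: le_trans (ler_wpM2l (ltW c0) h3) _.
  by rewrite mulrDr lerD2l invfM mulrA mulrCA mulrV ?mulr1 // unitfE gt_eqF.
lra.
Qed.

Definition inverse_family O (A B : EE -> {linear EE -> EE}) : Prop :=
  forall y v, O y -> B y (A y v) = v /\ A y (B y v) = v.

Section InverseFamily.
Variables (O : set EE) (A B : EE -> {linear EE -> EE}) (p : EE).
Hypotheses (oO : open O) (Op : O p) (AB : inverse_family O A B).

Let nearO : \forall y \near p, O y.
Proof. exact: open_nbhs_nbhs (conj oO Op). Qed.

Let bound : (forall v, {for p, continuous (fun x => A x v)}) ->
  exists2 c : R, 0 < c & \forall y \near p, forall v, `|B y v| <= c * `|v|.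
Proof.
move=> cA; apply: inverse_family_bound cA _ _ => [v|].
  by have [] := AB v Op.
by apply: filterS nearO => y Oy v; have [] := AB v Oy.
Qed.

(** Rests on the resolvent identity [B p - B y = - B y (A p - A y) B p]. *)
Lemma inverse_family_continuous :
  (forall v, {for p, continuous (fun x => A x v)}) ->
  forall v, {for p, continuous (fun y => B y v)}.
Proof.
move=> cA v; have [c c0 Bc] := bound cA.
apply/cvgrPdist_le => eps e0.
have ec : 0 < eps / c by rewrite divr_gt0.
have N1 : \forall y \near p, `|A p (B p v) - A y (B p v)| <= eps / c.
  exact: cvgr_dist_le (cA (B p v)) _ ec.
apply: filterS (filterI nearO (filterI Bc N1)) => y [Oy [By /= Ay]].
have -> : B p v - B y v = - B y (A p (B p v) - A y (B p v)).
  by rewrite linearB /= (AB (B p v) Oy).1 (AB v Op).2 opprB.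
rewrite normrN; apply: le_trans (By _) _.
by rewrite -ler_pdivlMl // mulrC.
Qed.

(** The classical formula [d(A^-1) = - A^-1 dA A^-1]. *)
Lemma inverse_family_diff v :
  (forall w, differentiable (fun y => A y w) p) ->
  differentiable (fun y => B y v) p /\
  'd (fun y => B y v) p =
    (fun u => - B p ('d (fun z => A z (B p v)) p u)) :> (EE -> EE).
Proof.
move=> dA.
have cA w : {for p, continuous (fun x => A x w)} by exact: differentiable_continuous.
have [c c0 Bc] := bound cA.
set w := B p v; set L := 'd (fun z => A z w) p.
have [l l0 Ll] := linear_bounded L.
apply: (@eps_differentiable _ _ _ _ (-%R \o (B p \o L))) => eps e0.
have e1 : 0 < eps / (2 * c) by rewrite divr_gt0 // mulr_gt0.
have e2 : 0 < eps / (2 * l) by rewrite divr_gt0 // mulr_gt0.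
have N1 := differentiable_epsP (dA w) e1.
have N2 := linear_family_near (inverse_family_continuous cA) e2.
apply: filterS (filterI nearO (filterI Bc (filterI N1 N2))) => y [Oy [By [/= h1 h2]]].
(* The error splits into the first-order remainder of [A], seen through [B y], and the variation of
   [B] on [L (y - p)]; each contributes [eps / 2]. *)
have -> : B y v - B p v - (- B p (L (y - p))) =
  - B y (A y w - A p w - L (y - p)) - (B y (L (y - p)) - B p (L (y - p))).
  set h := y - p; rewrite [B y (_ - _)]linearB [B y (A y w - _)]linearB /=.
  rewrite (AB w Oy).1 (AB v Op).2 -/w opprK !opprB.
  by rewrite [B p (L h) - _]addrC addrACA subrr add0r.
apply: le_trans (ler_normB _ _) _; rewrite normrN.
have h3 : `|B y (A y w - A p w - L (y - p))| <= eps / 2 * `|y - p|.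
  apply: le_trans (By _) _; rewrite -ler_pdivlMl // mulrA.
  by have -> : c^-1 * (eps / 2) = eps / (2 * c) by field; rewrite gt_eqF.
have h4 : `|B y (L (y - p)) - B p (L (y - p))| <= eps / 2 * `|y - p|.
  apply: le_trans (h2 _) _.
  have -> : eps / 2 * `|y - p| = eps / (2 * l) * (l * `|y - p|).
    by field; rewrite gt_eqF.
  by rewrite ler_wpM2l // ltW.
lra.
Qed.

End InverseFamily.

(** The derivative of the inverse involves [B] only undifferentiated, next to derivatives of [A], so
    [B] gains one class at each step of the induction. *)
Lemma inverse_family_class_C k O (A B : EE -> {linear EE -> EE}) : open O ->
  inverse_family O A B -> (forall v, class_C k O (fun y => A y v)) ->
  forall v, class_C k O (fun y => B y v).
Proof.
move=> oO AB; elim: k => [|k IH] CA v.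
  by move=> y Oy; apply: (inverse_family_continuous oO Oy AB) => w; exact: CA.
have dA y (Oy : O y) w := class_C_differentiable (CA w) Oy.
apply: class_CS => [y Oy|u].
  exact: (inverse_family_diff oO Oy AB v (dA y Oy)).1.
have CB w := IH (fun w => class_CW (CA w)) w.
have C1 : class_C k O (fun y => \sum_(e <- ebasis)
    dotv (B y v) e *: 'd (fun z => A z e) y u).
  apply: class_C_sum => // e; apply: class_C_dotscale => //.
  exact: class_C_diff u (CA e).
have C2 := class_C_app oO CB C1.
have C3 := class_C_comp (O := setT) openT oO _ (class_C_linear k setT -%R) C2.
apply: (class_C_eq oO _ (C3 _)) => // y Oy; apply/esym.
have E := (inverse_family_diff oO Oy AB v (dA y Oy)).2.
rewrite -(diff_linear_family (A := A) _ _ (dA y Oy)).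
exact: (congr1 (fun h : EE -> EE => h u) E).
Qed.

Lemma linear_inverse (A : {linear EE -> EE}) : (forall x, A x = 0 -> x = 0) ->
  exists B : {linear EE -> EE}, forall v, B (A v) = v /\ A (B v) = v.
Proof.
move=> inj.
have k0 : lker (linfun A) == 0%VS.
  rewrite -subv0; apply/subvP => x; rewrite memv_ker lfunE /= => /eqP/inj ->.
  exact: mem0v.
exists (linfun A)^-1%VF => v; split.
  by have := lker0_lfunK k0 v; rewrite lfunE.
by have := lker0_lfunVK k0 v; rewrite lfunE.
Qed.

End InverseFunction.

(** * The inverse function theorem *)

Section InverseFunction.
Context {R : realType} {EE : euclideanType R}.
Implicit Types (f g h H K : EE -> EE) (x y z u v w p : EE) (O : set EE) (k : nat).

(** The error of [K] is [- D] of the remainder of [H] at [K y]; the Lipschitz bound turns smallness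
    relative to [|K z - K y|] into smallness relative to [|z - y|]. *)
Lemma inverse_differentiable H K y (D : {linear EE -> EE}) (c : R) : 0 < c ->
  differentiable H (K y) ->
  (forall v, D ('d H (K y) v) = v) ->
  (\forall z \near y, H (K z) = z /\ `|K z - K y| <= c * `|z - y|) ->
  differentiable K y /\ 'd K y = D :> (EE -> EE).
Proof.
move=> c0 dH DA HK; apply: eps_differentiable => eps e0.
have [b b0 Db] := linear_bounded D.
have e1 : 0 < eps / (b * c) by rewrite divr_gt0 // mulr_gt0.
have /nbhs_ballP[r /= r0 Hr] := differentiable_epsP dH e1.
have yc : 0 < r / c by rewrite divr_gt0.
have B : \forall z \near y, ball y (r / c) z by exact: nbhsx_ballx.
have Hy := (nbhs_singleton HK).1.
apply: filterS2 B HK => z yz [HKz Kz].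
have zr : ball (K y) r (K z).
  rewrite -ball_normE /= distrC; apply: le_lt_trans Kz _.
  by rewrite -ltr_pdivlMl // mulrC distrC; move: yz; rewrite -ball_normE.
have := Hr _ zr; rewrite HKz Hy => h1.
have -> : K z - K y - D (z - y) = - D (z - y - 'd H (K y) (K z - K y)).
  by rewrite [D (_ - 'd _ _ _)]linearB /= DA opprB.
rewrite normrN; apply: le_trans (Db _) _.
apply: le_trans (ler_wpM2l (ltW b0) h1) _.
rewrite mulrA (_ : b * (eps / (b * c)) = eps / c); last by field; rewrite !gt_eqF.
apply: le_trans (ler_wpM2l _ Kz) _; first by rewrite divr_ge0 // ltW.
by rewrite mulrA divfK ?gt_eqF.
Qed.

(** Iterates [x |-> x + (y - H x)]: the new residual is the deviation of [H] from a translation, at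
    most half the old residual. *)
Lemma near_identity_surjective H p (r : R) :
  (forall x y, ball p r x -> ball p r y ->
     `|H y - H x - (y - x)| <= 2^-1 * `|y - x|) ->
  forall y, ball (H p) (r / 2) y -> exists2 x, ball p r x & H x = y.
Proof.
move=> lip0 y; rewrite -ball_normE /= => py.
have lip u v : `|u - p| < r -> `|v - p| < r ->
    `|H v - H u - (v - u)| <= 2^-1 * `|v - u|.
  by move=> pu pv; apply: lip0; rewrite -ball_normE /= distrC.
set d0 := `|y - H p|.
have d00 : 0 <= d0 by exact: normr_ge0.
have r0 : 2 * 1 * d0 < r by rewrite /d0 distrC; lra.
(* The second conjunct confines the next iterate to the ball too, where the Lipschitz hypothesis is
   needed. *)
pose P x (d : R) := `|y - H x| <= d /\ `|x - p| <= 2 * (d0 - d).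
have P0 : P p d0 by split => //; rewrite !subrr normr0 mulr0.
have step x d : 0 <= d <= d0 -> `|x - p| < r -> P x d ->
    exists2 x', P x' (d / 2) & `|x' - x| <= 1 * d.
  move=> /andP[dd0 dd1] xp [h1 h2]; exists (x + (y - H x)); last first.
    by rewrite addrC addKr mul1r.
  have xxp : `|x + (y - H x) - p| <= 2 * (d0 - d / 2).
    rewrite addrAC; apply: le_trans (ler_normD _ _) _; lra.
  split=> //.
  have := lip x (x + (y - H x)).
  rewrite [x + (y - H x) - x]addrC addKr => /(_ xp) l1.
  have : `|x + (y - H x) - p| < r by move: r0; rewrite mulr1; lra.
  move=> /l1; rewrite opprB addrA subrK distrC; lra.
have [w wp lim] := halving_iteration ler01 d00 r0 P0 step.
have wr : `|w - p| < r by exact: le_lt_trans wp r0.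
exists w; first by rewrite distrC.
apply/eqP; rewrite eq_sym -subr_eq0 -normr_eq0; apply/eqP/le_anti.
rewrite normr_ge0 andbT; apply/ler_addgt0Pr => eps e0; rewrite add0r.
have e3 : 0 < eps / 3 by rewrite divr_gt0.
have [x [d [xw /andP[dd0 de] dd1 [h1 h2]]]] := lim _ e3.
have xr : `|x - p| < r by move: r0; rewrite mulr1; lra.
have l1 := lip x w xr wr.
have l2 : `|H w - H x| <= `|H w - H x - (w - x)| + `|w - x|.
  by rewrite -{1}[H w - H x](subrK (w - x)) ler_normD.
have : `|y - H w| <= `|y - H x| + `|H w - H x|.
  by rewrite -{1}(subrKA (H x)) [X in _ <= _ + X]distrC ler_normD.
rewrite [`|w - x|]distrC in l1 l2; lra.
Qed.

(** The normalisation ['d H p = id] fits both uses, the chart of the intersection and the tubular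
    map, which are built to satisfy it. Near [p] the map is a half-contraction away from the
    identity, hence injective with a 2-Lipschitz inverse and onto a ball. *)
Theorem inverse_function k O H p : open O -> O p -> class_C k.+1 O H ->
  (forall v, 'd H p v = v) ->
  exists O' K, [/\ open O', O' p, O' `<=` O, open (H @` O') &
    class_C k.+1 (H @` O') K /\ forall x, O' x -> K (H x) = x].
Proof.
move=> oO Op CH dHp.
have h0 : 0 < 2^-1 :> R by [].
have [r r0 [rO Hr]] := class_C1_near oO Op CH h0.
have dH x : ball p r x -> differentiable H x.
  by move=> /rO; exact: class_C_differentiable CH.
have lip : forall x y, ball p r x -> ball p r y ->
    `|H y - H x - (y - x)| <= 2^-1 * `|y - x|.
  apply: (mean_value_ball (A := idfun)) => // z v pz /=.
  by rewrite -{2}[v]dHp; exact: Hr.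
have lip2 x y : ball p r x -> ball p r y -> `|y - x| <= 2 * `|H y - H x|.
  move=> px py; have := lip _ _ px py.
  have : `|y - x| <= `|H y - H x - (y - x)| + `|H y - H x|.
    by rewrite [X in _ <= X + _]distrC -{1}[y - x](subrK (H y - H x)) ler_normD.
  lra.
pose B := ball (H p) (r / 2).
have Bo : open B by apply: ball_open; rewrite divr_gt0.
(* Cutting the domain down by the preimage of [B] makes the image exactly [B], hence open. *)
pose O' := ball p r `&` H @^-1` B.
have O'o : open O'.
  rewrite openE => x [px Bx]; apply: filterI.
    by apply: open_nbhs_nbhs; split => //; exact: ball_open.
  have cH := differentiable_continuous (dH x px).
  exact: (cH B (open_nbhs_nbhs (conj Bo Bx))).
have O'p : O' p by split; apply: ballxx; rewrite ?divr_gt0.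
have HO' : H @` O' = B.
  apply/seteqP; split=> [_ [x [_ Bx] <-] // | y By].
  have [x px xy] := near_identity_surjective lip By.
  by exists x => //; split => //; rewrite /preimage /= xy.
pose K y := xget 0 [set x | O' x /\ H x = y].
have KP y : B y -> O' (K y) /\ H (K y) = y.
  by rewrite -HO' => -[x O'x xy]; rewrite /K; case: xgetP => [_ -> [] // | /(_ x)[]].
have KH x : O' x -> K (H x) = x.
  move=> [px Bx]; have [[pK _] HK] := KP _ Bx.
  apply/eqP; rewrite -subr_eq0 -normr_le0; apply: le_trans (lip2 _ _ px pK) _.
  by rewrite HK subrr normr0 mulr0.
have Klip y z : B y -> B z -> `|K z - K y| <= 2 * `|z - y|.
  move=> By Bz; have [[pKy _] HKy] := KP _ By; have [[pKz _] HKz] := KP _ Bz.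
  by have := lip2 _ _ pKy pKz; rewrite HKy HKz.
have dK y : B y -> differentiable K y /\
    forall v, 'd K y ('d H (K y) v) = v /\ 'd H (K y) ('d K y v) = v.
  move=> By; have [[pKy _] HKy] := KP _ By.
  have [|D AD] := linear_inverse (A := 'd H (K y)).
    move=> x Ax; apply/eqP; rewrite -normr_le0.
    have := Hr _ x pKy; rewrite Ax dHp sub0r normrN; lra.
  have [||d1 d2] := inverse_differentiable (D := D) (K := K) (ltr0Sn R 1) (dH _ pKy).
  - by move=> v; have [] := AD v.
  - apply: filterS (open_nbhs_nbhs (conj Bo By)) => z Bz.
    by split; [exact: (KP _ Bz).2|exact: Klip].
  by split=> // v; rewrite !(congr1 (fun h : EE -> EE => h _) d2).
exists O', K; rewrite HO'; split; [exact: O'o|exact: O'p|by move=> x [/rO]|exact: Bo|].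
split; last exact: KH.
(* Bootstrap: if [K] is C^j with [j <= k], then so is ['d H (K y)], hence its inverse ['d K y], and
   [K] is C^(j+1). *)
suff C j : (j <= k.+1)%N -> class_C j B K by exact: C.
elim: j => [_ y By|j IH jk].
  by apply: differentiable_continuous; exact: (dK y By).1.
apply: class_CS => [y By|]; first exact: (dK y By).1.
apply: (@inverse_family_class_C _ _ j B (fun y => 'd H (K y)) (fun y => 'd K y)) => //.
  by move=> y v By; exact: (dK y By).2.
move=> v; apply: (class_C_comp (O := O) (f := fun x => 'd H x v)) => //.
- by move=> y By; have [[/rO]] := KP _ By.
- by apply: class_C_leq (class_C_diff v CH).
exact/IH/ltnW.
Qed.

End InverseFunction.

(** * Linear algebra of transversality *)

Section LinearAlgebra.
Context {R : realType} {EE : euclideanType R}.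
Implicit Types (U T : {vspace EE}) (v : EE).

(** Grassmann's dimension formula; the inclusions bound the dimensions so that the truncated
    subtractions are exact. *)
Lemma codim_capv U T : codim (U :&: T)%VS = (codim U + codim T)%N ->
  (U + T = fullv)%VS.
Proof.
rewrite /codim => H; apply/eqP; rewrite eqEdim subvf /=.
have := dimv_sum_cap U T; have := dimvS (subvf U); have := dimvS (subvf T).
have := dimvS (capvSl U T); lia.
Qed.

(** As [U] and [T] may meet, the projector is taken along [T] onto a complement of [T] contained in
    [U]. *)
Lemma projector_along U T : (U + T = fullv)%VS ->
  exists P : {linear EE -> EE}, forall v,
    [/\ P v \in U, v - P v \in T & v \in T -> P v = 0].
Proof.
move=> UT; exists (addv_pi1 U T) => v.
have vE : addv_pi1 U T v + addv_pi2 U T v = v.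
  by apply: addv_pi1_pi2; rewrite UT memvf.
have vT : v - addv_pi1 U T v \in T.
  by rewrite -{1}vE addrC addKr memv_pi.
split=> //; first exact: memv_pi1.
move=> v_T; apply/eqP; rewrite -memv0 -(capv_diff U T) memv_cap memv_pi.
by rewrite -[X in X \in T](subKr v) rpredB.
Qed.

End LinearAlgebra.

(** * Slice charts, their estimates and tangent spaces *)

Section Charts.
Context {R : realType} {EE : euclideanType R}.
Implicit Types (V O : set EE) (L : {vspace EE}) (Phi Psi : EE -> EE).
Implicit Types (x y z u v w p q t : EE).

Section ChartPair.
Variables (k : nat) (O : set EE) (Phi Psi : EE -> EE).
Hypotheses (oO : open O) (oPhiO : open (Phi @` O)).
Hypotheses (CPhi : class_C k.+1 O Phi) (CPsi : class_C k.+1 (Phi @` O) Psi).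
Hypothesis PhiK : forall x, O x -> Psi (Phi x) = x.

(** Differentiating [Psi \o Phi = id] gives a left inverse, which finite dimension makes
    two-sided. *)
Lemma chart_diffK x v : O x ->
  'd Psi (Phi x) ('d Phi x v) = v /\ 'd Phi x ('d Psi (Phi x) v) = v.
Proof.
move=> Ox.
have dPhi := class_C_differentiable CPhi Ox.
have dPsi : differentiable Psi (Phi x).
  by apply: class_C_differentiable CPsi _; exists x.
have dK w : 'd Psi (Phi x) ('d Phi x w) = w.
  pose I : {linear EE -> EE} := idfun.
  have cI : continuous I by exact: linear_continuousv.
  have nid : \forall y \near x, I y = (Psi \o Phi) y.
    by apply: filterS (open_nbhs_nbhs (conj oO Ox)) => y Oy /=; rewrite PhiK.
  have E := (differentiable_near_eq nid (linear_differentiable x cI)).2.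
  have E1 := diff_comp dPhi dPsi.
  exact: (congr1 (fun h : EE -> EE => h w) (etrans (esym E1) (etrans E (diff_lin x cI)))).
split=> //.
have [|B AB] := linear_inverse (A := 'd Phi x).
  by move=> w w0; rewrite -[w]dK w0 linear0.
by rewrite -{1}[v](AB v).2 dK (AB v).2.
Qed.

End ChartPair.

(** Taylor bounds for [Psi] at [Phi p], pulled back by the Lipschitz bound for [Phi]. They compare a
    chord with its tangent part, a tangent displacement with a point reached through the chart, and
    nearby tangent spaces. *)
Lemma chart_estimates k O Phi Psi z : open O -> open (Phi @` O) ->
  class_C k.+2 O Phi -> class_C k.+2 (Phi @` O) Psi ->
  (forall x, O x -> Psi (Phi x) = x) -> O z ->
  exists r C : R, [/\ 0 < r, 0 < C, ball z r `<=` O &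
    [/\ forall p q, ball z r p -> ball z r q ->
          `|q - p - 'd Psi (Phi p) (Phi q - Phi p)| <= C * `|q - p| ^+ 2,
        forall p t, ball z r p -> `|t| < r ->
          (Phi @` O) (Phi p + 'd Phi p t) /\
          `|Psi (Phi p + 'd Phi p t) - p - t| <= C * `|t| ^+ 2 &
        forall p q v, ball z r p -> ball z r q ->
          `|'d Psi (Phi q) ('d Phi p v) - v| <= C * `|q - p| * `|v|]].
Proof.
move=> oO oPhiO CPhi CPsi PhiK Oz.
have [r1 [C1 [r10 C10 r1O [dPhi bPhi lPhi _ _]]]] := class_C2_taylor oO Oz CPhi.
have PhiOz : (Phi @` O) (Phi z) by exists z.
have [r2 [C2 [r20 C20 r2O [_ _ _ dlPsi tPsi]]]] := class_C2_taylor oPhiO PhiOz CPsi.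
(* With this radius [Phi p] stays within [r2 / 2] of [Phi z], leaving [r2 / 2] for the displacement
   ['d Phi p t]. *)
have r2C : 0 < r2 / (2 * C1) by rewrite divr_gt0 // mulr_gt0.
set r := Num.min r1 (r2 / (2 * C1)).
have [h1 h2] := ball_subset_min z r1 (r2 / (2 * C1)).
have rC : C1 * r <= r2 / 2.
  have -> : r2 / 2 = C1 * (r2 / (2 * C1)) by field; rewrite gt_eqF.
  by rewrite ler_wpM2l ?ge_min ?lexx ?orbT // ltW.
have zz : ball z r1 z by exact: ballxx.
have PhiB p : ball z r p -> `|Phi p - Phi z| < r2 / 2.
  move=> pz; apply: le_lt_trans (lPhi _ _ zz (h1 _ pz)) _.
  apply: lt_le_trans rC; rewrite ltr_pM2l // distrC.
  by move: pz; rewrite -ball_normE.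
have PhiB2 p : ball z r p -> ball (Phi z) r2 (Phi p).
  by move=> /PhiB; rewrite -ball_normE /= distrC; lra.
have dK p v (pz : ball z r p) := chart_diffK oO CPhi CPsi PhiK v (r1O _ (h1 _ pz)).
have C0 : 0 <= C2 by exact: ltW.
exists r, (C2 * C1 ^+ 2); split.
- by rewrite lt_min r10.
- by rewrite mulr_gt0 // exprn_gt0.
- by move=> p /h1/r1O.
have sq a b : 0 <= a -> a <= C1 * b -> C2 * a ^+ 2 <= C2 * C1 ^+ 2 * b ^+ 2.
  move=> a0 ab; rewrite -mulrA -exprMn ler_wpM2l // lerXn2r ?nnegrE //.
  exact: le_trans ab.
split.
- move=> p q pz qz; have := tPsi _ _ (PhiB2 _ pz) (PhiB2 _ qz).
  rewrite !PhiK; [|exact/r1O/h1..]; move=> /le_trans; apply; apply: sq => //.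
  by apply: lPhi; exact: h1.
- move=> p t pz tr.
  have ct : `|'d Phi p t| <= C1 * `|t| by apply: bPhi; exact: h1.
  have pt : ball (Phi z) r2 (Phi p + 'd Phi p t).
    rewrite -ball_normE /= distrC addrAC; apply: le_lt_trans (ler_normD _ _) _.
    have := PhiB _ pz; have : C1 * `|t| <= C1 * r by rewrite ler_wpM2l // ltW.
    lra.
  split; first exact: r2O.
  have := tPsi _ _ (PhiB2 _ pz) pt.
  rewrite PhiK; last exact/r1O/h1.
  by rewrite [Phi p + _]addrC addrK (dK _ _ pz).1 => /le_trans; apply; exact: sq.
- move=> p q v pz qz.
  rewrite -{2}[v](dK p v pz).1.
  apply: le_trans (dlPsi _ _ _ (PhiB2 _ pz) (PhiB2 _ qz)) _.
  have -> : C2 * C1 ^+ 2 * `|q - p| * `|v| = C2 * ((C1 * `|q - p|) * (C1 * `|v|)) by ring.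
  rewrite -mulrA ler_wpM2l // ler_pM //.
    by apply: lPhi; exact: h1.
  by apply: bPhi; exact: h1.
Qed.

Lemma is_derive_comp_diff (f : EE -> EE) (c : R -> EE) (s : R) (v : EE) :
  differentiable f (c s) -> is_derive s 1 c v ->
  is_derive s 1 (f \o c) ('d f (c s) v).
Proof.
move=> df [dc cv].
have dc' : differentiable c s by exact/derivable1_diffP.
have dfc : differentiable (f \o c) s by exact: differentiable_comp.
split; first exact/derivable1_diffP.
rewrite (deriveE _ dfc) (diff_comp dc' df) /=; congr ('d f (c s) _).
by rewrite -cv (deriveE _ dc').
Qed.

(** Near 0 the curve coincides with its projection onto [L], so its velocity is the projection of
    itself. *)
Lemma derive_in_vspace L (c : R -> EE) (v : EE) :
  (\forall s \near (0 : R), c s \in L) -> is_derive (0 : R) 1 c v -> v \in L.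
Proof.
move=> cL cv.
have cA : differentiable (oproj L) (c 0).
  by apply: linear_differentiable; exact: linear_continuousv.
have H := is_derive_comp_diff cA cv.
have [_ E1] : is_derive (0 : R) 1 c ('d (oproj L) (c 0) v).
  apply: near_eq_is_derive H; apply: filterS cL => s cs /=.
  by rewrite oproj_id.
have [_ E2] := cv.
rewrite -E2 E1 diff_lin; first exact: oproj_in.
exact: linear_continuousv.
Qed.

Lemma is_derive_line x v : is_derive (0 : R) 1 (fun s : R => x + s *: v) v.
Proof.
have d2 := is_diff_line x v 0.
split; first by apply/derivable1_diffP; exact: ex_diff.
rewrite deriveE; last exact: ex_diff.
by rewrite (diff_val (is_diff_def := d2)) scale1r.
Qed.

(** The vector [w] with ['d Phi x w] in [L] is the velocity of [Psi (Phi x + s 'd Phi x w)]. The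
    velocities thus form the preimage of [L], a subspace, and the default in [tangent] is not
    taken. *)
Lemma tangent_chart k V O L Phi Psi x v : slice_chart k.+1 V O L Phi Psi ->
  O x -> V x -> (v \in tangent V x) = ('d Phi x v \in L).
Proof.
move=> [oO oPhiO CPhi CPsi ch] Ox Vx.
have PhiK y : O y -> Psi (Phi y) = y by move=> /ch[].
have PhiL y : O y -> V y <-> Phi y \in L by move=> /ch[].
have dPhi := class_C_differentiable CPhi Ox.
have PhiOx : (Phi @` O) (Phi x) by exists x.
have dPsi := class_C_differentiable CPsi PhiOx.
have tvE w : tangent_vectors V x w <-> 'd Phi x w \in L.
  split=> [[c [c0 cV cw]] | wL].
    rewrite -c0; apply: (@derive_in_vspace _ (Phi \o c)); last first.
      by apply: is_derive_comp_diff cw; rewrite c0.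
    have cc : {for (0 : R), continuous c}.
      by apply: differentiable_continuous; apply/derivable1_diffP; case: cw.
    have cO : \forall s \near (0 : R), O (c s).
      by apply: (cc O); apply: open_nbhs_nbhs; split => //; rewrite c0.
    by apply: filterS2 cO cV => s Os /(PhiL _ Os).
  have line := is_derive_line (Phi x) ('d Phi x w).
  exists (Psi \o (fun s : R => Phi x + s *: 'd Phi x w)); split.
  - by rewrite /= scale0r addr0 PhiK.
  - have cl : {for (0 : R), continuous (fun s : R => Phi x + s *: 'd Phi x w)}.
      by apply: differentiable_continuous; apply/derivable1_diffP; case: line.
    have cO : \forall s \near (0 : R), (Phi @` O) (Phi x + s *: 'd Phi x w).
      apply: (cl (Phi @` O)); apply: open_nbhs_nbhs; split => //.
      by rewrite scale0r addr0.
    apply: filterS cO => s [y Oy yE] /=; rewrite -yE PhiK //.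
    apply/PhiL => //; rewrite yE rpredD ?rpredZ //.
    exact/PhiL.
  - have := is_derive_comp_diff (f := Psi) _ line; rewrite scale0r addr0.
    by rewrite (chart_diffK oO CPhi CPsi PhiK w Ox).1; exact.
have [T HT] : exists T : {vspace EE}, [set u | u \in T] = tangent_vectors V x.
  exists (linfun ('d Phi x) @^-1: L)%VS; apply/seteqP; split=> u /=.
    by rewrite -memv_preim lfunE /= => /tvE.
  by move=> /tvE uL; rewrite -memv_preim lfunE.
have tT : [set u | u \in tangent V x] = tangent_vectors V x.
  rewrite /tangent; case: xgetP => [T' _ // | /(_ T)].
  by rewrite /= HT.
apply/idP/idP => [vT|vL].
  by apply/tvE; rewrite -tT.
by have : tangent_vectors V x v by [apply/tvE]; rewrite -tT.
Qed.

End Charts.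

(** * Quantitative local geometry of the manifold *)

Section Geometry.
Context {R : realType} {EE : euclideanType R}.
Implicit Types (V O E : set EE) (L : {vspace EE}) (Phi Psi : EE -> EE).
Implicit Types (x y z u v w p q t e : EE).

(** The first three fields express curvature bounds. [lg_split] is transversality made uniform in
    [p]: every vector splits along [E0] and the tangent space with a controlled [E0] component. *)
Record local_geometry V (E0 : {vspace EE}) z (r C : R) : Prop := LocalGeometry {
  lg_secant : forall p q, V p -> V q -> ball z r p -> ball z r q ->
    exists2 t, t \in tangent V p & `|q - p - t| <= C * `|q - p| ^+ 2;
  lg_lift : forall p t, V p -> ball z r p -> t \in tangent V p -> `|t| < r ->
    exists2 q, V q & `|p + t - q| <= C * `|t| ^+ 2;
  lg_gap : forall p q v, V p -> V q -> ball z r p -> ball z r q ->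
    v \in tangent V p ->
    exists2 v', v' \in tangent V q & `|v - v'| <= C * `|q - p| * `|v|;
  lg_split : forall p v, V p -> ball z r p ->
    exists e, [/\ e \in E0, v - e \in tangent V p & `|e| <= C * `|v|] }.

Lemma local_geometry_le V (E0 : {vspace EE}) z (r r' C C' : R) : r' <= r -> C <= C' ->
  local_geometry V E0 z r C -> local_geometry V E0 z r' C'.
Proof.
move=> rr CC [secant lift gap split].
have sub := le_ball rr.
constructor.
- move=> p q Vp Vq /sub pz /sub qz.
  have [t tT H] := secant p q Vp Vq pz qz; exists t => //.
  by apply: le_trans H _; rewrite ler_wpM2r // exprn_ge0.
- move=> p t Vp /sub pz tT tr.
  have [q Vq H] := lift p t Vp pz tT (lt_le_trans tr rr); exists q => //.
  by apply: le_trans H _; rewrite ler_wpM2r // exprn_ge0.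
- move=> p q v Vp Vq /sub pz /sub qz vT.
  have [v' v'T H] := gap p q v Vp Vq pz qz vT; exists v' => //.
  by apply: le_trans H _; rewrite !ler_wpM2r.
- move=> p v Vp /sub pz; have [e [h1 h2 h3]] := split p v Vp pz.
  by exists e; split => //; apply: le_trans h3 _; rewrite ler_wpM2r.
Qed.

Lemma manifold_local_geometry k V (E0 : {vspace EE}) z : manifold k.+2 V ->
  V z -> (E0 + tangent V z = fullv)%VS ->
  exists r C : R, [/\ 0 < r, 0 < C & local_geometry V E0 z r C].
Proof.
move=> [d /(_ z)] mV Vz E0T.
case: (mV Vz) => O [L [Phi [Psi [Oz _ ch]]]].
have [oO oPhiO CPhi CPsi chP] := ch.
have PhiK x : O x -> Psi (Phi x) = x by move=> /chP[].
have PhiL x : O x -> V x <-> Phi x \in L by move=> /chP[].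
have tE x v : O x -> V x -> (v \in tangent V x) = ('d Phi x v \in L).
  by move=> Ox Vx; exact: tangent_chart ch Ox Vx.
have dK x v (Ox : O x) := chart_diffK oO CPhi CPsi PhiK v Ox.
have [r [C [r0 C0 rO [sec lift gap]]]] :=
  chart_estimates oO oPhiO CPhi CPsi PhiK Oz.
have [P HP] := projector_along E0T.
have [c c0 Pc] := linear_bounded P.
(* At this scale the variation of the tangent space, applied to [u - P u] with
   [|u - P u| <= (1 + c) |u|], is at most [|u| / 2]. *)
pose s := Num.min r (2 * C * (1 + c))^-1.
have Cc0 : 0 < 2 * C * (1 + c) by rewrite !mulr_gt0 // addr_gt0.
have s0 : 0 < s by rewrite lt_min r0 invr_gt0.
have sr : s <= r by rewrite ge_min lexx.
have zs : `|z - z| < s by rewrite subrr normr0.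
exists s, (C + 2 * c); split => //; first by rewrite addr_gt0 // mulr_gt0.
have CC : C <= C + 2 * c by rewrite lerDl mulr_ge0 // ltW.
have sub x : ball z s x -> ball z r x by exact: le_ball.
have zz : ball z r z by exact: ballxx.
constructor.
- move=> p q Vp Vq /sub pz /sub qz.
  exists ('d Psi (Phi p) (Phi q - Phi p)).
    rewrite tE //; last exact: rO.
    rewrite (dK _ _ (rO _ pz)).2 rpredB //; first exact/PhiL/Vq/rO.
    exact/PhiL/Vp/rO.
  apply: le_trans (sec _ _ pz qz) _.
  by rewrite ler_wpM2r // exprn_ge0.
- move=> p t Vp /sub pz tT ts.
  have [[q Oq qE] H] := lift _ _ pz (lt_le_trans ts sr).
  rewrite -qE PhiK // in H; exists q.
    apply/PhiL => //; rewrite qE rpredD //; first exact/PhiL/Vp/rO.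
    by rewrite -tE //; exact: rO.
  rewrite distrC opprD addrA; apply: le_trans H _.
  by rewrite ler_wpM2r // exprn_ge0.
- move=> p q v Vp Vq /sub pz /sub qz vT.
  exists ('d Psi (Phi q) ('d Phi p v)).
    rewrite tE //; last exact: rO.
    by rewrite (dK _ _ (rO _ qz)).2 -tE //; exact: rO.
  rewrite distrC; apply: le_trans (gap _ _ _ pz qz) _.
  by rewrite !ler_wpM2r.
move=> p v Vp ps; have pz := sub _ ps.
(* Keep the [E0] part of [u] and transport its tangent part from [z] to [p]. As [M] is within one
   half of the identity it is onto, and solving [M u = v] splits [v] at [p]. *)
pose M : {linear EE -> EE} :=
  P \+ ('d Psi (Phi p) \o ('d Phi z \o (idfun \- P))).
have ME u : M u = P u + 'd Psi (Phi p) ('d Phi z (u - P u)) by [].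
have Mid u : `|M u - u| <= 2^-1 * `|u|.
  have -> : M u - u = 'd Psi (Phi p) ('d Phi z (u - P u)) - (u - P u).
    by rewrite ME opprB addrCA addrA.
  apply: le_trans (gap _ _ _ zz pz) _.
  have h1 : `|u - P u| <= (1 + c) * `|u|.
    by apply: le_trans (ler_normB _ _) _; rewrite mulrDl mul1r lerD2l.
  have h2 : `|p - z| <= (2 * C * (1 + c))^-1.
    rewrite distrC; move: ps; rewrite -ball_normE /= /s lt_min => /andP[_ h].
    exact: ltW.
  have -> : 2^-1 * `|u| = C * (2 * C * (1 + c))^-1 * ((1 + c) * `|u|).
    by field; rewrite !gt_eqF // addr_gt0.
  by rewrite ler_pM // ?mulr_ge0 ?ler_wpM2l // ltW.
have [u uE] : exists u, M u = v.
  apply: injective_linear_surj => w Mw; apply/eqP; rewrite -normr_le0.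
  by have := Mid w; rewrite Mw sub0r normrN; lra.
have [PuE uPu _] := HP u.
exists (P u); split=> //.
  rewrite -uE ME addrC addKr tE //; last exact: rO.
  by rewrite (dK _ _ (rO _ pz)).2 -tE //; exact: rO.
have : `|u| <= 2 * `|v|.
  have := Mid u; rewrite uE => h.
  have : `|u| <= `|v - u| + `|v| by rewrite distrC -{1}[u](subrK v) ler_normD.
  lra.
move=> uv; apply: le_trans (Pc _) _.
have : c * `|u| <= c * (2 * `|v|) by rewrite ler_wpM2l // ltW.
have : 0 <= C * `|v| by rewrite mulr_ge0 // ltW.
by rewrite mulrDl; lra.
Qed.

End Geometry.

(** * Nearest points and affine subspaces *)

Section Nearest.
Context {R : realType} {EE : euclideanType R}.
Implicit Types (S : set EE) (L T : {vspace EE}) (a x y z u v w p q : EE).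

Lemma nearest_le S x p q : nearest S x p -> S q -> `|x - p| <= `|x - q|.
Proof.
move=> [_ H] Sq; have [-> //|qp] := eqVneq q p.
by apply/ltW/H => //; exact/eqP.
Qed.

Lemma nearest_unique S x p q : nearest S x p -> nearest S x q -> p = q.
Proof.
move=> np nq; apply: contrapT => pq.
have := np.2 q nq.1 (not_eq_sym pq); rewrite ltNge.
by rewrite (nearest_le nq np.1).
Qed.

Lemma nearest_projP S x : proj_defined S x -> nearest S x (nearest_proj S x).
Proof. by move=> [p np]; rewrite /nearest_proj; case: xgetP => [? -> //|/(_ p)]. Qed.

Lemma nearest_projE S x p : nearest S x p -> nearest_proj S x = p.
Proof.
by move=> np; apply: nearest_unique (np); apply: nearest_projP; exists p.
Qed.

(** A point at distance 0 from [S] that has a nearest point in [S] equals it; existence of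
    projections thus stands in for closedness. *)
Lemma locally_closed S z (r : R) x :
  (forall y, ball z r y -> proj_defined S y) -> ball z r x ->
  (forall eps : R, 0 < eps -> exists2 s, S s & `|x - s| < eps) -> S x.
Proof.
move=> projS zx cl; have [p np] := projS x zx.
suff -> : x = p by case: np.
apply/eqP; rewrite -subr_eq0 -normr_le0; apply/ler_addgt0Pr => eps e0.
have [s Ss xs] := cl eps e0; rewrite add0r.
exact: le_trans (nearest_le np Ss) (ltW xs).
Qed.

Lemma affine_nearest a L x : nearest (affine a L) x (a + oproj L (x - a)).
Proof.
split; first by rewrite /affine /= addrC addKr oproj_in.
move=> q qL qp; set p := a + _ in qp *.
have -> : x - q = (x - p) + (p - q) by rewrite subrKA.
have pq : p - q \in L.
  rewrite -(subrKA a) -[a - q]opprB rpredB // /p addrC addKr; exact: oproj_in.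
have orth : dotv (x - p) (p - q) = 0.
  by rewrite /p opprD addrA; exact: oproj_orth.
rewrite -(ltr_pXn2r (n := 2)) ?nnegrE // (pythagoras orth).
by rewrite ltrDl exprn_gt0 // normr_gt0 subr_eq0 eq_sym; apply/eqP.
Qed.

Lemma affine_recenter a b L : affine a L b -> affine a L = affine b L.
Proof.
rewrite /affine /= => ab; apply/seteqP; split=> y /= yL.
  by rewrite -(subrKA a) -[a - b]opprB rpredB.
by rewrite -(subrKA b) rpredD.
Qed.

Lemma affine_capv a L T : affine a L `&` affine a T = affine a (L :&: T)%VS.
Proof.
by apply/seteqP; split=> y; rewrite /affine /= memv_cap; [case=> -> ->|move/andP].
Qed.

End Nearest.

(** * Quadratic convergence near the intersection point *)

Section LocalConvergence.
Context {R : realType} {EE : euclideanType R}.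
Variables (V U : set EE) (E0 : {vspace EE}) (z : EE) (r C : R).
Implicit Types (x y u v w p q t e : EE).

Let E := affine z E0.
Let W := E `&` V `&` U.

Hypotheses (r0 : 0 < r) (C1 : 1 <= C) (lg : local_geometry V E0 z r C).
Hypothesis projV : forall x, ball z r x -> proj_defined V x.
Hypothesis Vz : V z.

Let C0 : 0 < C. Proof. exact: lt_le_trans C1. Qed.

Let Ez : E z. Proof. by rewrite /E /affine /= subrr mem0v. Qed.

Let Eadd x e : E x -> e \in E0 -> E (x + e).
Proof. by rewrite /E /affine /= addrAC => h1 h2; rewrite rpredD. Qed.

Let inball x (s : R) : ball z s x = (`|x - z| < s) :> Prop.
Proof. by rewrite -ball_normE /= distrC. Qed.

(** With [x1] in E and [y1] in V, split [x1 - y1 = e + t] along [E0] and the tangent space at [y1].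
    Then [x1 - e = y1 + t] is still in E, and lifting [y1 + t] back to V leaves only a quadratic
    gap. *)
Lemma metric_regularity : exists rho K : R, [/\ 0 < rho, 0 < K &
  forall x y (d : R), E x -> `|x - z| < rho -> V y -> `|x - y| <= d -> d < rho ->
    exists w, [/\ E w, V w & `|x - w| <= K * d]].
Proof.
pose C' := C * (1 + C) ^+ 2.
have C'0 : 0 < C' by rewrite mulr_gt0 // exprn_gt0 // addr_gt0.
(* The first bound keeps the iterates and their partners in V inside the ball of radius [r]; the
   second makes the new gap [C' d^2], coming from [|t| <= (1 + C) d], at most [d / 2]. *)
pose rho := Num.min (r / (8 * (1 + C))) (2 * C')^-1.
have cc : 0 < 8 * (1 + C) by rewrite mulr_gt0 // addr_gt0.
have rho0 : 0 < rho by rewrite lt_min divr_gt0 // invr_gt0 mulr_gt0.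
exists rho, (2 * C); split=> //; first by rewrite mulr_gt0.
move=> x y d Ex xz Vy xy dr.
have d0 : 0 <= d by exact: le_trans xy.
have rho1 : 8 * (1 + C) * rho <= r.
  by rewrite mulrC -ler_pdivlMr // ge_min lexx.
have rho2 : 2 * C' * rho <= 1.
  have cc2 : 0 < 2 * C' by rewrite pmulr_rgt0.
  by rewrite -(ler_pdivlMl _ _ cc2) mulr1 ge_min lexx orbT.
have c1 := C1; have r0' := r0; have c16 : 16 <= 8 * (1 + C) by lra.
have rhor : 16 * rho <= r by apply: le_trans rho1; rewrite (ler_wpM2r (ltW rho0)).
have Crho : C * rho <= r / 8.
  by move: rho1; rewrite mulrDr mulr1 mulrDl -mulrA; lra.
have Cd : C * d <= C * rho by rewrite ler_wpM2l // ltW.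
pose P x' (d' : R) := E x' /\ exists2 y', V y' & `|x' - y'| <= d'.
have P0 : P x d by split => //; exists y.
have dr4 : 2 * C * d < r / 3 by rewrite -mulrA; lra.
have step x1 d1 : 0 <= d1 <= d -> `|x1 - x| < r / 3 -> P x1 d1 ->
    exists2 x', P x' (d1 / 2) & `|x' - x1| <= C * d1.
  move=> /andP[d10 d1d] x1x [Ex1 [y1 Vy1 xy1]].
  have y1z : ball z r y1.
    have -> : ball z r y1 = (`|(y1 - x1) + (x1 - x) + (x - z)| < r) :> Prop.
      by rewrite inball !subrKA.
    apply: le_lt_trans (ler_normD _ _) _.
    have := ler_normD (y1 - x1) (x1 - x); rewrite [`|y1 - _|]distrC; lra.
  have [e [eE eT eC]] := lg_split lg (x1 - y1) Vy1 y1z.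
  have eC' : `|e| <= C * d1 by apply: le_trans eC _; rewrite ler_wpM2l // ltW.
  set t := x1 - y1 - e in eT.
  have tC : `|t| <= (1 + C) * d1.
    by apply: le_trans (ler_normB _ _) _; rewrite mulrDl mul1r lerD.
  have Cd1 : C * d1 <= C * d by rewrite ler_wpM2l // ltW.
  have tr : `|t| < r by apply: le_lt_trans tC _; rewrite mulrDl mul1r; lra.
  have [q Vq qC] := lg_lift lg Vy1 y1z eT tr.
  exists (x1 - e); last by rewrite addrC addKr normrN.
  split; first by apply: Eadd => //; rewrite rpredN.
  exists q => //.
  have -> : x1 - e = y1 + t by rewrite /t addrA [y1 + _]addrC subrK.
  apply: le_trans qC _.
  have h1 : C * `|t| ^+ 2 <= C' * d1 ^+ 2.
    by rewrite /C' -mulrA -exprMn ler_wpM2l ?lerXn2r ?nnegrE // ?(le_trans _ tC) // ltW.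
  apply: le_trans h1 _; rewrite expr2 mulrA [d1 / 2]mulrC ler_wpM2r //.
  have : C' * d1 <= C' * rho by rewrite ler_wpM2l // ltW // (le_lt_trans d1d).
  by move: rho2; rewrite -mulrA; lra.
have [w wx lim] := halving_iteration (ltW C0) d0 dr4 P0 step.
have wr : ball z r w.
  rewrite inball -(subrKA x); apply: le_lt_trans (ler_normD _ _) _; lra.
exists w; split; last by rewrite distrC.
  apply: (@locally_closed _ _ E z r) => // [y' _|eps e0].
    by exists (z + oproj E0 (y' - z)); exact: affine_nearest.
  have [x' [d' [h1 _ _ [h2 _]]]] := lim eps e0.
  by exists x' => //; rewrite distrC.
apply: (@locally_closed _ _ V z r) => // eps e0.
have e2 : 0 < eps / 2 by rewrite divr_gt0.
have [x' [d' [h1 /andP[_ h2] _ [_ [y' Vy' h3]]]]] := lim _ e2.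
exists y' => //; rewrite -(subrKA x'); apply: le_lt_trans (ler_normD _ _) _.
rewrite distrC; lra.
Qed.

Hypothesis UB : forall x, ball z r x -> U x.

(* The points of W near w + s u, given by metric regularity at distance O(s^2),
   show that W has every direction u of E0 and T_w as a tangent direction. *)
Lemma nearest_orthogonal : exists2 rho : R, 0 < rho &
  forall x w u, `|w - z| < rho -> nearest W x w -> u \in (E0 :&: tangent V w)%VS ->
    dotv (x - w) u = 0.
Proof.
have c1 := C1; have r0' := r0.
have [rho [K [rho0 K0 reg]]] := metric_regularity.
exists (Num.min (rho / 2) (r / 2)) => [|x w u]; first by rewrite lt_min !divr_gt0.
rewrite lt_min => /andP[wrho wr] nw.
(* The one-sided inequality is applied to [u] and to [- u]. *)
suff H v : v \in (E0 :&: tangent V w)%VS -> dotv (x - w) v <= 0.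
  move=> uET; apply/le_anti; rewrite H //=.
  by have := H (- u); rewrite rpredN dotvNr oppr_le0; exact.
rewrite memv_cap => /andP[vE vT].
have [[[Ew Vw] Uw] _] := nw.
have wz : ball z r w by rewrite inball; lra.
pose M := K * (C * `|v| ^+ 2).
have M0 : 0 <= M by rewrite !mulr_ge0 ?exprn_ge0 // ltW.
(* Minimality of [w] against [w + h] gives [2 <x - w, h> <= |h|^2]. With [h = s v] up to [s^2 M]
   this becomes [2 s <x - w, v> <= s^2 N]. *)
pose N := 2 * `|x - w| * M + (`|v| + M) ^+ 2.
have N0 : 0 <= N.
  by apply: addr_ge0; [apply: mulr_ge0 M0; exact: mulr_ge0|exact: sqr_ge0].
apply/ler_addgt0Pr => eps e0; rewrite add0r.
pose D := 1 + `|v| + C * `|v| ^+ 2 + M.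
have Cv0 : 0 <= C * `|v| ^+ 2 by rewrite mulr_ge0 ?exprn_ge0 // ltW.
have v0 : 0 <= `|v| by exact: normr_ge0.
have D0 : 0 < D by rewrite /D; lra.
(* Small enough for the comparison points to stay within reach of metric regularity and inside [U],
   and for [s N] to be below [eps]. *)
pose s := Num.min 1 (Num.min (Num.min (rho / (2 * D)) (r / (2 * D))) (eps / (1 + N))).
have s0 : 0 < s.
  have N1 : 0 < 1 + N by rewrite ltr_wpDr.
  have D2 : 0 < 2 * D by rewrite pmulr_rgt0.
  by rewrite /s !lt_min ltr01 !divr_gt0.
have s1 : s <= 1 by rewrite ge_min lexx.
have sD1 : D * s <= rho / 2.
  rewrite mulrC -ler_pdivlMr //.
  have -> : rho / 2 / D = rho / (2 * D) by field; rewrite gt_eqF.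
  by rewrite !ge_min lexx !orbT.
have sD2 : D * s <= r / 2.
  rewrite mulrC -ler_pdivlMr //.
  have -> : r / 2 / D = r / (2 * D) by field; rewrite gt_eqF.
  by rewrite !ge_min lexx !orbT.
have sN : (1 + N) * s <= eps.
  by rewrite mulrC -ler_pdivlMr ?ltr_wpDr // !ge_min lexx !orbT.
have ss : s ^+ 2 <= s by rewrite expr2 ler_piMl // ltW.
have ss0 : 0 <= s ^+ 2 by rewrite exprn_ge0 // ltW.
have nsv : `|s *: v| = s * `|v| by rewrite normrZ gtr0_norm.
have DE : D * s = s + s * `|v| + s * (C * `|v| ^+ 2) + s * M by rewrite /D; ring.
have sv0 : 0 <= s * `|v| by rewrite mulr_ge0 // ltW.
have sCv0 : 0 <= s * (C * `|v| ^+ 2) by rewrite mulr_ge0 // ltW.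
have sM0 : 0 <= s * M by rewrite mulr_ge0 // ltW.
have svr : `|s *: v| < r by rewrite nsv; lra.
have svT : s *: v \in tangent V w by rewrite rpredZ.
have [q Vq qC] := lg_lift lg Vw wz svT svr.
have qC' : `|w + s *: v - q| <= s ^+ 2 * (C * `|v| ^+ 2).
  by apply: le_trans qC _; rewrite nsv exprMn mulrCA.
have s2C : s ^+ 2 * (C * `|v| ^+ 2) <= s * (C * `|v| ^+ 2) by rewrite ler_wpM2r.
have s2M : s ^+ 2 * M <= s * M by rewrite ler_wpM2r.
have Ewv : E (w + s *: v) by apply: Eadd => //; rewrite rpredZ.
have wvz : `|w + s *: v - z| < rho.
  by rewrite addrAC; apply: le_lt_trans (ler_normD _ _) _; rewrite nsv; lra.
have drho : s ^+ 2 * (C * `|v| ^+ 2) < rho by lra.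
have [w' [Ew' Vw' w'C]] := reg _ _ _ Ewv wvz Vq qC' drho.
rewrite mulrCA -/M in w'C.
have Ww' : W w'.
  split=> //; apply: UB; rewrite inball.
  have -> : w' - z = (w - z) + s *: v - (w + s *: v - w').
    by rewrite opprB [w - z + _]addrAC [RHS]addrC subrKA.
  apply: le_lt_trans (ler_normB _ _) _.
  have := ler_normD (w - z) (s *: v); rewrite nsv; lra.
have := nearest_le nw Ww'.
set h := w' - w.
have -> : x - w' = (x - w) - h by rewrite /h opprB addrA subrK.
rewrite -(ler_pXn2r (n := 2)) ?nnegrE // (normvB2 (x - w) h) => hh.
have hE : h = s *: v - (w + s *: v - w').
  by rewrite /h opprB [RHS]addrC opprD addrA subrK.
have nh : `|h| <= s * (`|v| + M).
  by rewrite hE; apply: le_trans (ler_normB _ _) _; rewrite nsv mulrDr; lra.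
have nh2 : `|h| ^+ 2 <= s ^+ 2 * (`|v| + M) ^+ 2.
  by rewrite -exprMn lerXn2r ?nnegrE // mulr_ge0 ?addr_ge0 // ltW.
have dh : s * dotv (x - w) v - `|x - w| * (s ^+ 2 * M) <= dotv (x - w) h.
  rewrite hE dotvBr dotvZr lerD2l lerN2; apply: le_trans (dotv_le _ _) _.
  by rewrite ler_wpM2l.
have key : s * (2 * dotv (x - w) v) <= s * (s * N).
  have -> : s * (s * N) = 2 * (`|x - w| * (s ^+ 2 * M)) + s ^+ 2 * (`|v| + M) ^+ 2.
    by rewrite /N; ring.
  have -> : s * (2 * dotv (x - w) v) = 2 * (s * dotv (x - w) v) by ring.
  lra.
rewrite ler_pM2l // in key.
by move: sN; rewrite mulrDl mul1r [N * s]mulrC; lra.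
Qed.

Let Wz : W z. Proof. by split=> //; exact/UB/ballxx. Qed.

Lemma phi_step : exists rho K : R, [/\ 0 < rho, 0 < K &
  forall x w, `|x - z| < rho -> nearest W x w ->
    [/\ U x, phi_defined V E x & `|phi V E x - w| <= K * `|x - w| ^+ 2]].
Proof.
have [rho0 rho00 orth] := nearest_orthogonal.
have c1 := C1; have r0' := r0.
(* The factor 10 is 4 + 2 + 4, from the bounds on [e], [v] and [P e] below. Halving the radii
   accounts for [w] and [y] being up to twice as far from [z] as [x]. *)
exists (Num.min (r / 2) (rho0 / 2)), (10 * C ^+ 2); split.
- by rewrite lt_min !divr_gt0.
- by rewrite mulr_gt0 // exprn_gt0.
move=> x w; rewrite lt_min => /andP[xr xrho] nw.
have xw : `|x - w| <= `|x - z| by exact: nearest_le nw Wz.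
have wz : `|w - z| <= 2 * `|x - z|.
  have := ler_normD (w - x) (x - z); rewrite subrKA [`|w - x|]distrC; lra.
have xB : ball z r x by rewrite inball; lra.
have wB : ball z r w by rewrite inball; lra.
have ny := nearest_projP (projV xB).
set y := nearest_proj V x in ny *.
have [[[Ew Vw] Uw] _] := nw.
have Vy : V y by case: ny.
have xy : `|x - y| <= `|x - w| by exact: nearest_le ny Vw.
have yz : `|y - z| <= 2 * `|x - z|.
  have := ler_normD (y - x) (x - z); rewrite subrKA [`|y - x|]distrC; lra.
have yB : ball z r y by rewrite inball; lra.
have wy : `|w - y| <= 2 * `|x - w|.
  have := ler_normD (w - x) (x - y); rewrite subrKA [`|w - x|]distrC; lra.
set d := `|x - w| in xw wy xy *.
have d0 : 0 <= d by exact: normr_ge0.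
have C0' : 0 <= C by exact: ltW.
have wy2 : `|w - y| ^+ 2 <= 4 * d ^+ 2.
  have -> : 4 * d ^+ 2 = (2 * d) ^+ 2 by ring.
  by rewrite lerXn2r ?nnegrE // mulr_ge0.
have [t tT tC] := lg_secant lg Vy Vw yB wB.
have [e [eE eT eC]] := lg_split lg (w - y - t) Vy yB.
have eC' : `|e| <= 4 * C ^+ 2 * d ^+ 2.
  apply: le_trans eC _; apply: le_trans (ler_wpM2l C0' tC) _.
  have -> : 4 * C ^+ 2 * d ^+ 2 = C * (C * (4 * d ^+ 2)) by ring.
  by rewrite !ler_wpM2l.
(* A common point of E and the tangent space at [y], at distance O(d^2) from [w]: the tangent part
   of [w - y] accounts for all but a quadratic remainder, which transversality splits. *)
pose a := w - e.
have Ea : E a by apply: Eadd => //; rewrite rpredN.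
have ya : affine_tangent V y a.
  rewrite /affine_tangent /affine /= (_ : a - y = t + (w - y - t - e)).
    exact: rpredD.
  by rewrite /a [RHS]addrC [RHS]addrAC subrK addrAC.
have SE : E `&` affine_tangent V y = affine a (E0 :&: tangent V y)%VS.
  by rewrite /E /affine_tangent (affine_recenter Ea) (affine_recenter ya) affine_capv.
have np := affine_nearest a (E0 :&: tangent V y)%VS x.
have phiE : phi V E x = a + oproj (E0 :&: tangent V y)%VS (x - a).
  by rewrite /phi -/y SE; exact: nearest_projE.
split; first exact: UB.
  by split; [exact: projV|rewrite -/y SE; exists (a + oproj (E0 :&: tangent V y)%VS (x - a))].
rewrite phiE; set P := oproj _.
set v := P (x - w).
have vET : v \in (E0 :&: tangent V y)%VS by exact: oproj_in.
have [vE vT] : v \in E0 /\ v \in tangent V y by apply/andP; rewrite -memv_cap.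
have [v' v'T v'C] := lg_gap lg Vy Vw yB wB vT.
have [e' [e'E e'T e'C]] := lg_split lg (v - v') Vw wB.
have e'C' : `|e'| <= 2 * C ^+ 2 * d * `|v|.
  apply: le_trans e'C _; apply: le_trans (ler_wpM2l C0' v'C) _.
  have -> : 2 * C ^+ 2 * d * `|v| = C * (C * (2 * d) * `|v|) by ring.
  by rewrite ler_wpM2l // ler_wpM2r // ler_wpM2l.
have uET : v - e' \in (E0 :&: tangent V w)%VS.
  rewrite memv_cap rpredB //=.
  rewrite (_ : v - e' = v' + (v - v' - e')); first exact: rpredD.
  by rewrite [RHS]addrC [RHS]addrAC subrK.
(* [|v|^2 = <x - w, v>] because [v] projects [x - w], and this equals [<x - w, e'>] because [v - e']
   is tangent to E and V at [w]; finally [e'] is O(d |v|). *)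
have vd : `|v| <= 2 * C ^+ 2 * d ^+ 2.
  apply: ler_sqr_mul => //; first by rewrite !mulr_ge0 ?sqr_ge0.
  have := oproj_orth (x - w) vET; rewrite -/P -/v dotvBl dotvv => /eqP.
  rewrite subr_eq0 => /eqP <-.
  have wrho : `|w - z| < rho0 by lra.
  have := orth x w _ wrho nw uET; rewrite dotvBr => /eqP; rewrite subr_eq0 => /eqP ->.
  apply: le_trans (dotv_le _ _) _; rewrite -/d.
  have -> : 2 * C ^+ 2 * d ^+ 2 * `|v| = d * (2 * C ^+ 2 * d * `|v|) by ring.
  by rewrite ler_wpM2l.
have -> : a + P (x - a) - w = - e + v + P e.
  have -> : x - a = (x - w) + e by rewrite /a opprB addrA addrAC.
  by rewrite linearD /= -/v addrAC /a [w - e]addrC addrK addrA.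
apply: le_trans (ler_normD _ _) _.
have := ler_normD (- e) v; rewrite normrN.
have := norm_oproj (E0 :&: tangent V y)%VS e; rewrite -/P.
lra.
Qed.

Hypothesis projW : forall x, ball z r x -> proj_defined W x.

Lemma local_quadratic_convergence : exists nu gamma gamma' : R,
  [/\ 0 < nu, 0 < gamma, 0 < gamma' &
    forall x0, ball z nu x0 ->
      let x := fun i : nat => iter i (phi V E) x0 in
      (forall i, U (x i) /\ phi_defined V E (x i)) /\
      exists xoo,
        [/\ W xoo,
            x i @[i --> \oo] --> xoo,
            forall i, `|x i.+1 - xoo| <= gamma * `|x i - xoo| ^+ 2,
            proj_defined W x0 &
            `|nearest_proj W x0 - xoo| <=
              gamma' * `|nearest_proj W x0 - x0| ^+ 2]].
Proof.
have [rho [K [rho0 K0 step]]] := phi_step.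
pose s := Num.min rho r.
(* [K nu <= 1 / 2] gives [K d^2 <= d / 2]. The iterates stay within [5 nu] of [z] and the limit
   within [4 nu], so [s / 9] leaves room. *)
pose nu := Num.min (s / 9) (2 * K)^-1.
have s0 : 0 < s by rewrite lt_min rho0.
have K20 : 0 < 2 * K by rewrite mulr_gt0.
have nu0 : 0 < nu by rewrite lt_min invr_gt0 divr_gt0.
have nus : 9 * nu <= s by rewrite -ler_pdivlMl // mulrC ge_min lexx.
have nuK : 2 * K * nu <= 1.
  by rewrite -(ler_pdivlMl _ _ K20) mulr1 ge_min lexx orbT.
have sr : s <= r by rewrite ge_min lexx orbT.
have srho : s <= rho by rewrite ge_min lexx.
exists nu, (5 * K), (4 * K); split; rewrite ?mulr_gt0 //.
move=> x0; rewrite inball => x0z x.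
pose w i := nearest_proj W (x i).
pose d i := `|x i - w i|.
have d_ge0 i : 0 <= d i by exact: normr_ge0.
have nW i : `|x i - z| < s -> nearest W (x i) (w i).
  by move=> xi; apply/nearest_projP/projW; rewrite inball; lra.
have d0nu : d 0%N < nu.
  apply: (le_lt_trans _ x0z); apply: (fun h => nearest_le h Wz); apply: nW; rewrite /x /=; lra.
have one i : `|x i - z| < s -> d i < nu -> [/\ U (x i), phi_defined V E (x i),
    `|x i.+1 - w i| <= K * d i ^+ 2 & K * d i ^+ 2 <= d i / 2].
  move=> xi di; have [|h1 h2 h3] := step (x i) (w i) _ (nW _ xi); first by lra.
  split=> //.
  rewrite expr2 mulrA [d i / 2]mulrC ler_wpM2r //.
  have : K * d i <= K * nu by rewrite ler_wpM2l // ltW.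
  lra.
(* The quantity [4 d i] pays for the displacement: a step moves by at most [2 d i] while [d] at
   least halves. *)
have inv i : `|x i - x0| <= 4 * (d 0%N - d i) /\ d i < nu.
  elim: i => [|i [IH1 IH2]]; first by rewrite /x /= !subrr normr0 mulr0.
  have xi : `|x i - z| < s.
    have := ler_normD (x i - x0) (x0 - z); rewrite subrKA.
    have := d_ge0 i; lra.
  have [_ _ h3 h4] := one i xi IH2.
  have x1i : `|x i.+1 - x i| <= 2 * d i.
    have := ler_normD (x i.+1 - w i) (w i - x i); rewrite subrKA [`|w i - _|]distrC.
    rewrite -/(d i); have := d_ge0 i; lra.
  have x1z : `|x i.+1 - z| < s.
    have := ler_normD (x i.+1 - x i) (x i - x0).
    have := ler_normD (x i.+1 - x i + (x i - x0)) (x0 - z).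
    rewrite !subrKA; have := d_ge0 i; lra.
  have d1 : d i.+1 <= `|x i.+1 - w i|.
    by apply: nearest_le (nW _ x1z) _; case: (nW _ xi).
  have := ler_normD (x i.+1 - x i) (x i - x0); rewrite subrKA.
  have := d_ge0 i; split; lra.
have xs i : `|x i - z| < s.
  have [IH1 IH2] := inv i.
  have := ler_normD (x i - x0) (x0 - z); rewrite subrKA.
  have := d_ge0 i; lra.
have Ww i : W (w i) by case: (nW _ (xs i)).
have dS i : d i.+1 <= K * d i ^+ 2.
  have [_ _ h3 _] := one i (xs i) (inv i).2.
  by apply: le_trans h3; apply: nearest_le (nW _ (xs _)) _.
have dhalf i : d i.+1 <= d i / 2.
  by have [_ _ _ h4] := one i (xs i) (inv i).2; exact: le_trans (dS i) h4.
have d2half i : d i.+1 ^+ 2 <= d i ^+ 2 / 2.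
  have : d i.+1 ^+ 2 <= (d i / 2) ^+ 2.
    by rewrite lerXn2r ?nnegrE // divr_ge0.
  have := sqr_ge0 (d i); rewrite exprMn; lra.
have wS i : `|w i.+1 - w i| <= 2 * K * d i ^+ 2.
  have [_ _ h3 _] := one i (xs i) (inv i).2.
  have := ler_normD (w i.+1 - x i.+1) (x i.+1 - w i); rewrite subrKA.
  rewrite [`|w i.+1 - _|]distrC -/(d i.+1); have := dS i; lra.
have d2_ge0 i : 0 <= d i ^+ 2 by exact: sqr_ge0.
(* The gauge is [d i ^+ 2] instead of [d i], so the tail bound [4 K d_i^2] is itself quadratic.
   Hence [gamma = K + 4 K], and [gamma' = 4 K] at [i = 0]. *)
have [xoo wxoo wle] := halving_cvg (ltW K20) d2_ge0 d2half wS.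
split; first by move=> i; have [h1 h2 _ _] := one i (xs i) (inv i).2.
have xcvg : x i @[i --> \oo] --> xoo.
  have dx : x i - w i @[i --> \oo] --> (0 : EE).
    by apply/norm_cvg0P; exact: (halving_cvg0 d_ge0 dhalf).
  have := cvgD dx wxoo; rewrite add0r; under eq_cvg do rewrite subrK.
  exact.
have xooB : ball z r xoo.
  rewrite inball; have := wle 0%N.
  have : K * d 0%N * d 0%N <= d 0%N / 2.
    by have [_ _ _] := one 0%N (xs 0%N) d0nu; rewrite expr2 mulrA.
  have := ler_normD (xoo - w 0%N) (w 0%N - x0); rewrite subrKA.
  have := ler_normD (xoo - x0) (x0 - z); rewrite subrKA.
  rewrite [`|xoo - w _|]distrC [`|w _ - x0|]distrC -/(d 0%N) expr2; lra.
have Wxoo : W xoo.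
  apply: (@locally_closed _ _ W z r) => // eps e0.
  have : \forall i \near \oo, `|xoo - w i| < eps by exact: cvgr_dist_lt.
  by case=> N _ /(_ N (leqnn N)) /= h; exists (w N).
exists xoo; split=> //.
- move=> i; have [_ _ h3 _] := one i (xs i) (inv i).2.
  have := ler_normD (x i.+1 - w i) (w i - xoo); rewrite subrKA => h1.
  have h2 : d i <= `|x i - xoo| by exact: nearest_le (nW _ (xs i)) Wxoo.
  have h4 : d i ^+ 2 <= `|x i - xoo| ^+ 2 by rewrite lerXn2r ?nnegrE.
  have h5 : 5 * K * d i ^+ 2 <= 5 * K * `|x i - xoo| ^+ 2.
    by rewrite ler_wpM2l // mulr_ge0 // ltW.
  have := wle i; lra.
- by exists (w 0%N); exact: nW (xs 0%N).
- have := wle 0%N; rewrite /d /w /x /= [`|x0 - _|]distrC.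
  by rewrite (_ : 2 * (2 * K) = 4 * K) //; ring.
Qed.

End LocalConvergence.

(** * A chart of the intersection, and adjoints *)

Section Existence.
Context {R : realType} {EE : euclideanType R}.
Implicit Types (V O U W : set EE) (L : {vspace EE}) (Phi Psi : EE -> EE).
Implicit Types (x y z u v w p q t e n : EE).

(** [Theta] keeps the part of [x - z] tangent to V and replaces the complementary part by
    [P (D (Phi x - Phi z))], which vanishes exactly on V. On V, [Theta x] lies in [E0] iff [x - z]
    does, as [P] has values in [E0]. Its differential at [z] is [id - P + P = id]. *)
Lemma intersection_chart k V (E0 : {vspace EE}) z (r : R) : 0 < r ->
  manifold k.+1 V -> V z -> (E0 + tangent V z = fullv)%VS ->
  exists O Theta Xi, [/\ open O, O z, O `<=` ball z r,
    slice_chart k.+1 (affine z E0 `&` V `&` O) O (E0 :&: tangent V z)%VS Theta Xi &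
    Theta z = 0 /\ forall v, 'd Theta z v = v].
Proof.
move=> r0 [d /(_ z)] mV Vz E0T.
case: (mV Vz) => O [L [Phi [Psi [Oz _ ch]]]].
have [oO oPhiO CPhi CPsi chP] := ch.
have PhiK x : O x -> Psi (Phi x) = x by move=> /chP[].
have PhiL x : O x -> V x <-> Phi x \in L by move=> /chP[].
have tE v : (v \in tangent V z) = ('d Phi z v \in L).
  exact: tangent_chart ch Oz Vz.
have [|D DK] := linear_inverse (A := 'd Phi z).
  move=> x x0; have [<- _] := chart_diffK oO CPhi CPsi PhiK x Oz.
  by rewrite x0 linear0.
have [P HP] := projector_along E0T.
have PE v : P v \in E0 by have [] := HP v.
have PT v : v - P v \in tangent V z by have [] := HP v.
have P0 v : v \in tangent V z -> P v = 0 by have [] := HP v.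
have P0E v : P v = 0 -> v \in tangent V z by move=> Pv; have := PT v; rewrite Pv subr0.
have PB v : P (v - P v) = 0 by apply: P0.
have PP v : P (P v) = P v by apply/esym/eqP; rewrite -subr_eq0 -linearB PB.
pose A1 : {linear EE -> EE} := idfun \- P.
pose A2 : {linear EE -> EE} := P \o D.
pose c := - (z - P z) - P (D (Phi z)).
(* Grouped with the constant [c] to make smoothness immediate; [ThetaE] gives the centred form. *)
pose Theta x := A1 x + (A2 (Phi x) + c).
have ThetaE x : Theta x = (x - z - P (x - z)) + P (D (Phi x - Phi z)).
  rewrite /Theta /A1 /A2 /c /= !linearB /=.
  by rewrite !opprK [x - z + _]addrACA -[RHS]addrA; congr (_ + _); rewrite addrCA.
have CT : class_C k.+1 O Theta.
  have C2 := class_C_comp openT oO (fun y _ => Logic.I)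
    (class_C_linear k.+1 setT A2) CPhi.
  exact: class_C_add oO (class_C_linear k.+1 O A1)
    (class_C_add oO C2 (class_C_cst k.+1 O c)).
have dT v : 'd Theta z v = v.
  have cA (A : {linear EE -> EE}) : continuous A by exact: linear_continuousv.
  have dA (A : {linear EE -> EE}) x : differentiable A x.
    exact: linear_differentiable (cA A).
  have dPhi := class_C_differentiable CPhi Oz.
  have d2 := differentiable_comp dPhi (dA A2 (Phi z)).
  have d3 := differentiableD d2 (differentiable_cst c z).
  have E1 := diffD (dA A1 z) d3.
  have E2 := diffD d2 (differentiable_cst c z).
  have E3 := diff_comp dPhi (dA A2 (Phi z)).
  pose ev := fun h : EE -> EE => h v.
  have F2 := etrans (congr1 ev E2) (congr2 +%R
    (etrans (congr1 ev E3) (congr1 (fun h : EE -> EE => h ('d Phi z v)) (diff_lin _ (cA A2))))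
    (congr1 ev (diff_cst c z))).
  have F1 := etrans (congr1 ev E1)
    (congr2 +%R (congr1 ev (diff_lin z (cA A1))) F2).
  rewrite [LHS]F1 /ev.
  by rewrite /A1 /A2 /= (DK v).1 addr0 subrK.
have oO1 : open (O `&` ball z r) by apply: openI => //; exact: ball_open.
have O1z : (O `&` ball z r) z by split => //; exact: ballxx.
have CT1 : class_C k.+1 (O `&` ball z r) Theta by apply: class_C_subset CT => x [].
case: (inverse_function oO1 O1z CT1 dT) =>
  O' [Xi [oO' O'z O'sub oTO' [CXi XiK]]].
have key x : O x -> (affine z E0 x /\ V x) <-> Theta x \in (E0 :&: tangent V z)%VS.
  move=> Ox; rewrite memv_cap.
  have PTh : P (Theta x) = P (D (Phi x - Phi z)).
    by rewrite ThetaE linearD /= PB add0r PP.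
  have DV : V x <-> P (D (Phi x - Phi z)) = 0.
    split=> [Vx|/P0E].
      by apply: P0; rewrite tE (DK _).2 rpredB //; apply/PhiL.
    rewrite tE (DK _).2 => h; apply/PhiL => //.
    by rewrite -(subrK (Phi z) (Phi x)) rpredD //; apply/PhiL.
  split=> [[Ex Vx]|/andP[TE TT]].
    have D0 := DV.1 Vx; apply/andP; split; last by apply: P0E; rewrite PTh.
    by rewrite ThetaE D0 addr0 rpredB.
  have D0 : P (D (Phi x - Phi z)) = 0 by rewrite -PTh; exact: P0.
  split; last exact/DV.
  move: TE; rewrite ThetaE D0 addr0 => h.
  by rewrite /affine /= -(subrK (P (x - z)) (x - z)) rpredD.
exists O', Theta, Xi; split; [exact: oO'|exact: O'z|by move=> x /O'sub[]| |].
  split; [exact: oO'|exact: oTO'|exact: class_C_subset CT1|exact: CXi|].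
  move=> x O'x; split; first exact: XiK.
  have [Ox _] := O'sub _ O'x; split=> [[[Ex Vx] _]|h].
    exact: (key x Ox).1 (conj Ex Vx).
  by have [Ex Vx] := (key x Ox).2 h.
by split; [rewrite ThetaE !subrr !linear0 !addr0|exact: dT].
Qed.

(** The adjoint of [A], written in the orthonormal basis. *)
Definition adjv (A : {linear EE -> EE}) w : EE :=
  \sum_(e <- ebasis) dotv (A e) w *: e.

Lemma dotv_adjv (A : {linear EE -> EE}) w v : dotv (adjv A w) v = dotv w (A v).
Proof.
rewrite /adjv dotv_suml [in RHS]linear_sum_ebasis dotv_sumr.
by apply: eq_bigr => e _; rewrite dotvZl dotvZr mulrC [dotv e v]dotvC [dotv w _]dotvC.
Qed.

Lemma adjv_near_id (A : {linear EE -> EE}) w (eps : R) : 0 <= eps ->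
  (forall v, `|A v - v| <= eps * `|v|) -> `|adjv A w - w| <= eps * `|w|.
Proof.
move=> e0 H; apply: ler_sqr_mul => //; first exact: mulr_ge0.
rewrite -dotvv [X in dotv X _]/(_ - _) dotvBl dotv_adjv -dotvBr.
apply: le_trans (dotv_le _ _) _; apply: le_trans (ler_wpM2l _ (H _)) _ => //.
by rewrite mulrCA mulrA.
Qed.

Lemma class_C_adjv k O (A : EE -> {linear EE -> EE}) (f : EE -> EE) : open O ->
  (forall v, class_C k O (fun x => A x v)) -> class_C k O f ->
  class_C k O (fun x => adjv (A x) (f x)).
Proof.
move=> oO CA Cf; apply: (class_C_sum _ oO) => e.
apply: (class_C_eq (f := fun x =>
  \sum_(b <- ebasis) dotv (f x) b *: (dotv (A x e) b *: e)) oO).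
  move=> x _; rewrite -[in RHS](ebasisE (f x)) dotv_sumr scaler_suml.
  by apply: eq_bigr => b _; rewrite dotvZr scalerA.
apply: (class_C_sum _ oO) => b.
exact: class_C_dotscale oO Cf (class_C_dotscale b oO (CA e) (class_C_cst k O e)).
Qed.

End Existence.

(** * The tubular map and smoothness of the nearest-point projection *)

Section Tubular.
Context {R : realType} {EE : euclideanType R}.
Implicit Types (V O U W : set EE) (L : {vspace EE}).
Implicit Types (x y z u v w p q t e n : EE).

(* In the chart (Theta, Xi), the map H sends p = l + n, with l in L and n
   orthogonal to L, to Xi l + dTheta^* n: the second term is normal to W at
   Xi l, and every normal vector is of this form.  So H^-1 followed by l |-> Xi l
   is the nearest-point projection. *)
Lemma chart_projection k W O L (Theta Xi : EE -> EE) z :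
  slice_chart k.+2 W O L Theta Xi -> W `<=` O -> W z ->
  Theta z = 0 -> (forall v, 'd Theta z v = v) -> proj_C_around k.+1 W z.
Proof.
move=> [oO oTO CT CX chP] WO Wz Tz dTz.
have Oz : O z := WO z Wz.
have TK x : O x -> Xi (Theta x) = x by move=> /chP[].
have TL x : O x -> W x <-> Theta x \in L by move=> /chP[].
have XO y : (Theta @` O) y -> O (Xi y) /\ Theta (Xi y) = y.
  by move=> [x Ox <-]; rewrite TK.
pose pr := oproj L.
have cpr : continuous pr by exact: linear_continuousv.
pose N := pr @^-1` (Theta @` O).
have oN : open N by exact: open_comp.
have N0 : N 0 by exists z => //; rewrite linear0.
pose a p := Xi (pr p).
have a0 : a 0 = z by rewrite /a linear0 -Tz TK.
have aO p : N p -> O (a p) by move=> /XO[].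
have CX' := class_C_leq (leqnSn k.+1) CX.
have Ca : class_C k.+1 N a.
  exact: class_C_comp oTO oN (fun p Np => Np) CX' (class_C_linear k.+1 N pr).
pose nn : {linear EE -> EE} := idfun \- pr.
pose S p := adjv ('d Theta (a p)) (nn p).
(* The differential of [Theta] enters the tubular map, which costs one class of
   differentiability. *)
have Cg e : class_C k.+1 N (fun p => 'd Theta (a p) e).
  exact: (class_C_comp oO oN aO (class_C_diff e CT) Ca).
have CS : class_C k.+1 N S.
  exact: (@class_C_adjv _ _ _ _ (fun p => 'd Theta (a p)) _ oN Cg (class_C_linear k.+1 N nn)).
pose H p := a p + S p.
have CH : class_C k.+1 N H by exact: class_C_add.
have S0 : S 0 = 0.
  by rewrite /S linear0 /adjv big1 // => e _; rewrite dotv0r scale0r.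
have H0 : H 0 = z by rewrite /H S0 a0 addr0.
have da : differentiable a 0 by exact: class_C_differentiable Ca N0.
have dav v : 'd a 0 v = pr v.
  have dX : differentiable Xi (pr 0).
    by apply: class_C_differentiable CX _.
  have dpr : differentiable pr 0 by exact: linear_differentiable.
  have E1 := congr1 (fun h : EE -> EE => h v) (diff_comp dpr dX).
  have E2 := congr1 (fun h : EE -> EE => h v) (diff_lin 0 cpr).
  have E3 := etrans E1 (congr1 (fun w => 'd Xi (pr 0) w) E2).
  rewrite [LHS]E3 linear0 -Tz -[RHS](chart_diffK oO CT CX TK _ Oz).1.
  by rewrite dTz.
(* No derivative of the coefficients is needed: ['d Theta (a p)] tends to the identity, hence so
   does its adjoint, and it acts on [nn p], which is O(|p|). *)
have [dS dSv] : differentiable S 0 /\ 'd S 0 = nn :> (EE -> EE).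
  apply: eps_differentiable => eps e0.
  have e2 : 0 < eps / 2 by rewrite divr_gt0.
  have cg v : {for (0 : EE), continuous (fun p => 'd Theta (a p) v)}.
    exact: class_C_continuous (Cg v) N0.
  have := linear_family_near (A := fun p => 'd Theta (a p)) cg e2.
  apply: filterS => p gp; rewrite S0 !subr0.
  have h1 : `|S p - nn p| <= eps / 2 * `|nn p|.
    apply: adjv_near_id; first exact: ltW.
    by move=> v; have := gp v; rewrite a0 dTz.
  have h2 : `|nn p| <= 2 * `|p|.
    have := ler_normB p (pr p); have := norm_oproj L p; rewrite -/pr /nn /=; lra.
  have : eps / 2 * `|nn p| <= eps / 2 * (2 * `|p|) by rewrite ler_wpM2l // ltW.
  lra.
have dH v : 'd H 0 v = v.
  have E1 := congr1 (fun h : EE -> EE => h v) (diffD da dS).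
  have E2 := congr2 +%R (dav v) (congr1 (fun h : EE -> EE => h v) dSv).
  by rewrite [LHS](etrans E1 E2) /nn /= addrC subrK.
case: (inverse_function oN N0 CH dH) => O' [K [oO' O'0 O'N oHO [CK KH]]].
have HK x : (H @` O') x -> O' (K x) /\ H (K x) = x.
  by move=> [p O'p <-]; rewrite KH.
pose q x := a (K x).
have KN x : (H @` O') x -> N (K x) by move=> /HK[/O'N].
have Cq : class_C k.+1 (H @` O') q by exact: class_C_comp oN oHO KN Ca CK.
have HOz : (H @` O') z by exists 0.
have qz : q z = z by rewrite /q -{1}H0 KH.
have [r [C [r0 C0 rO [sec _ _]]]] := chart_estimates oO oTO CT CX TK Oz.
(* [r / 4] disposes of competitors outside the chart ball; [8 C dl <= 1] makes the curvature term
   [4 C dl |h|^2] at most [|h|^2 / 2]. *)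
pose dl := Num.min (r / 4) (8 * C)^-1.
have C80 : 0 < 8 * C by rewrite mulr_gt0.
have dl0 : 0 < dl by rewrite lt_min divr_gt0 // invr_gt0.
have dlr : 4 * dl <= r by rewrite -ler_pdivlMl // mulrC ge_min lexx.
have dlC : 8 * C * dl <= 1 by rewrite -(ler_pdivlMl _ _ C80) mulr1 ge_min lexx orbT.
have inball x (s : R) : ball z s x = (`|x - z| < s) :> Prop.
  by rewrite -ball_normE /= distrC.
have near_z : \forall x \near z, [/\ (H @` O') x, `|q x - z| < dl & `|x - z| < dl].
  have n1 : \forall x \near z, (H @` O') x by exact: open_nbhs_nbhs.
  have n2 : \forall x \near z, `|q z - q x| < dl.
    have cq := class_C_continuous Cq HOz.
    exact: cvgr_dist_lt cq _ dl0.
  have n3 : \forall x \near z, ball z dl x by exact: nbhsx_ballx.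
  apply: filterS3 n1 n2 n3 => x h1 h2 h3; split=> //.
    by rewrite -{1}qz distrC.
  by rewrite -inball.
have /nbhs_ballP[rho /= rho0 Hrho] := near_z.
have near_proj x : ball z rho x -> nearest W x (q x).
  move=> /Hrho[HOx qxz xz].
  have [KO' HKx] := HK x HOx; have NK := KN x HOx.
  set p := K x in KO' HKx NK.
  have [qO Tq] := XO _ NK; rewrite -/(a p) -/(q x) in qO Tq.
  have Wq : W (q x) by apply/TL => //; rewrite Tq oproj_in.
  split=> // q' Wq' qq'.
  have xq : x - q x = adjv ('d Theta (q x)) (nn p).
    by rewrite -{1}HKx /H /S -/(q x) addrC addKr.
  have nxq : `|x - q x| < 2 * dl.
    have := ler_normD (x - z) (z - q x); rewrite subrKA [`|z - _|]distrC; lra.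
  (* A competitor outside the ball is at distance at least [r - dl >= 3 dl] from [x], whereas
     [|x - q x| < 2 dl]. *)
  have [zq'|/negP zq'] := boolP (`|q' - z| < r); last first.
    have := ler_normD (q' - x) (x - z); rewrite subrKA [`|q' - x|]distrC.
    move/negP: zq'; rewrite -leNgt; lra.
  have zB : ball z r (q x) by rewrite inball; lra.
  have zB' : ball z r q' by rewrite inball.
  set t := 'd Xi (Theta (q x)) (Theta q' - Theta (q x)).
  have ht : `|q' - q x - t| <= C * `|q' - q x| ^+ 2 by exact: sec.
  (* Moving the adjoint across leaves [nn p], orthogonal to [L], against [Theta q' - Theta (q x)],
     which lies in [L]. *)
  have orth : dotv (x - q x) t = 0.
    rewrite xq dotv_adjv (chart_diffK oO CT CX TK _ qO).2.
    apply: oproj_orth; rewrite rpredB //; [exact/TL/Wq'/WO|exact/TL].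
  set h := q' - q x in ht.
  have h0 : 0 < `|h| by rewrite normr_gt0 subr_eq0; apply/eqP.
  have dh : dotv (x - q x) h <= `|x - q x| * (C * `|h| ^+ 2).
    rewrite -[h in X in X <= _](subrK t) dotvDr orth addr0.
    apply: le_trans (dotv_le _ _) _.
    by rewrite ler_wpM2l.
  have xq' : x - q' = (x - q x) - h by rewrite /h opprB addrA subrK.
  rewrite -(ltr_pXn2r (n := 2)) ?nnegrE // xq' (normvB2 (x - q x) h).
  have hh : 0 < `|h| ^+ 2 by rewrite exprn_gt0.
  have : `|x - q x| * (C * `|h| ^+ 2) <= (2 * dl) * (C * `|h| ^+ 2).
    by rewrite ler_wpM2r ?mulr_ge0 // ltW.
  have : 8 * C * dl * `|h| ^+ 2 <= 1 * `|h| ^+ 2 by rewrite ler_wpM2r // ltW.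
  lra.
exists (ball z rho); split; [exact: ball_open|exact: ballxx|split].
  by move=> x /near_proj nx; exists (q x).
have Cq' : class_C k.+1 (ball z rho) q.
  by apply: class_C_subset Cq => x /Hrho[].
apply: (class_C_eq _ _ Cq'); first exact: ball_open.
by move=> x /near_proj/nearest_projE.
Qed.

End Tubular.

(** The existence clause keeps the universally quantified one from being vacuous; [nu], [gamma] and
    [gamma'] may depend on [U]. *)
Theorem theorem4p1 (R : realType) (EE : euclideanType R)
    (V : set EE) (E : set EE) (E0 : {vspace EE}) (zeta : EE)
    (V_manifold : manifold 3 V) (V_neq : V <> [set: EE])
    (E_affine : affine_subspace E E0) (E_proper : E <> [set: EE])
    (zetaEV : (E `&` V) zeta)
    (projV_C2 : proj_C_around 2 V zeta)
    (transversalVE : transversal_at V E0 zeta) :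
  (exists U : set EE, adapted_nbhd V E zeta U) /\
  forall U : set EE, adapted_nbhd V E zeta U ->
    let W := E `&` V `&` U in
    exists nu gamma gamma' : R,
      [/\ 0 < nu, 0 < gamma, 0 < gamma' &
        forall x0 : EE, ball zeta nu x0 ->
          let x := fun i : nat => iter i (phi V E) x0 in
          (forall i, U (x i) /\ phi_defined V E (x i)) /\
          exists xoo : EE,
            [/\ W xoo,
                x i @[i --> \oo] --> xoo,
                forall i, `|x i.+1 - xoo| <= gamma * `|x i - xoo| ^+ 2,
                proj_defined W x0 &
                `|nearest_proj W x0 - xoo| <= gamma' * `|nearest_proj W x0 - x0| ^+ 2]].
Proof.
have [Ez Vz] := zetaEV.
have EE0 : E = affine zeta E0.
  have [b Eb] := E_affine; rewrite Eb; apply: affine_recenter.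
  by rewrite -Eb.
have E0T := codim_capv transversalVE.
have [r1 [C1 [r10 C10 lg]]] := manifold_local_geometry V_manifold Vz E0T.
rewrite EE0; split.
  case: projV_C2 => OV [oOV OVz [projV CV]].
  have /nbhs_ballP[r2 /= r20 Hr2] := open_nbhs_nbhs (conj oOV OVz).
  (* Since [|y - zeta| <= 2 |x - zeta|] for the nearest point [y] of V, [r1 / 2] places [y] where
     [lg_split] applies. *)
  pose r := Num.min r2 (r1 / 2).
  have r0 : 0 < r by rewrite lt_min r20 divr_gt0.
  case: (intersection_chart r0 V_manifold Vz E0T) =>
    U [Th [Xi [oU Uz Ur ch [Tz dTz]]]].
  have Wz : (affine zeta E0 `&` V `&` U) zeta by rewrite -EE0.
  have UOV : U `<=` OV.
    by move=> x /Ur xr; apply: Hr2; apply: le_ball xr; rewrite ge_min lexx.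
  exists U; split.
  - by split.
  - split; first by move=> x /UOV/projV.
    exact: class_C_subset UOV CV.
  - move=> x Ux; have ny := nearest_projP (projV x (UOV x Ux)).
    set y := nearest_proj V x in ny *.
    have xr : `|x - zeta| < r1 / 2.
      by have := Ur x Ux; rewrite -ball_normE /= distrC lt_min => /andP[].
    have yB : ball zeta r1 y.
      rewrite -ball_normE /=.
      have := ler_normD (zeta - x) (x - y); rewrite subrKA [`|zeta - x|]distrC.
      have := nearest_le ny Vz; lra.
    (* Splitting [zeta - y = e + t] exhibits [zeta - e = y + t] in E and in the affine tangent space
       at [y]. *)
    have [e [eE eT _]] := lg_split lg (zeta - y) ny.1 yB.
    exists (zeta - e); split; last first.
      by rewrite /affine_tangent /affine /= addrAC.
    by rewrite /affine /= addrC addKr rpredN.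
  - exists (\dim (E0 :&: tangent V zeta)) => x [_ Ux].
    by exists U, (E0 :&: tangent V zeta)%VS, Th, Xi.
  - by apply: chart_projection ch _ Wz Tz dTz => x [].
move=> U [[oU Uz] [projV _] _ _ [OW [oOW OWz [projW _]]]] W.
have /nbhs_ballP[r2 /= r20 Hr2] := open_nbhs_nbhs (conj (openI oU oOW) (conj Uz OWz)).
pose r := Num.min r1 r2.
have r0 : 0 < r by rewrite lt_min r10.
have rU x : ball zeta r x -> U x /\ OW x.
  by move=> xr; apply: Hr2; apply: le_ball xr; rewrite ge_min lexx orbT.
(* The local convergence result takes a constant at least 1, whence [1 + C1]. *)
have lg' : local_geometry V E0 zeta r (1 + C1).
  by apply: local_geometry_le lg; rewrite ?ge_min ?lexx // lerDr.
apply: (local_quadratic_convergence r0 _ lg') => //.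
- by rewrite lerDl ltW.
- by move=> x /rU[/projV].
- by move=> x /rU[].
- by move=> x /rU[_ /projW].
Qed.
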